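(* Let $X$ be a Banach space with Pełczyński's property $(u)$ and let $C\in\mathcal{B}(X)$. Then $C$ is weakly compact if and only if $C$ has the $\mathcal{G}$-FPP for the class of uniformly bi-Lipschitz affine mappings $f$ such that $\theta(f)>0$.
   Context: For a convex subset $M$ of a Banach space, $\mathcal{B}(M)$ denotes the family of all nonempty bounded, closed, convex subsets of $M$. Property $(u)$: a Banach space $X$ has Pełczyński's property $(u)$ if for every weak Cauchy sequence $(x_n)$ in $X$ there is a sequence $(y_n)\subset X$ such that (1) $\sum_{n=1}^\infty|x^*(y_n)|<\infty$ for all $x^*\in X^*$, and (2) $\big(x_n-\sum_{i=1}^n y_i\big)_n$ converges weakly to zero. $\mathcal{G}$-FPP (generic fixed point property): a set $C\in\mathcal{B}(X)$ has the $\mathcal{G}$-FPP for a class $\mathcal{M}$ of mappings if whenever $K\in\mathcal{B}(C)$, every $f\in\mathcal{M}$ satisfying $f(K)\subset K$ (i.e. every self-map $f\colon K\to K$ belonging to the class) has a fixed point in $K$. A map $f\colon K\to K$ is uniformly bi-Lipschitz if there exist constants $c_1,c_2>0$ such that $c_1\|x-y\|\le\|f^p(x)-f^p(y)\|\le c_2\|x-y\|$ for all $x,y\in K$ and all $p\in\mathbb{N}$, where $f^p$ is the $p$-th iterate of $f$. A map $f$ on a convex set $K$ is affine if $f(tx+(1-t)y)=tf(x)+(1-t)f(y)$ for all $x,y\in K$, $t\in[0,1]$. For a nonempty convex $K\subset X$ and an affine map $f\colon K\to K$, $\theta(f)=\inf\big\{\liminf_{n\to\infty}\|x-f^n(y)\|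 : x,y\in K\big\}$. *)

(* Defs.v *)
From HB Require Import structures.
From mathcomp Require Import all_boot all_order all_algebra.
From mathcomp Require Import all_classical all_reals all_analysis.

Set Implicit Arguments.
Unset Strict Implicit.
Unset Printing Implicit Defensive.

Import Order.TTheory GRing.Theory Num.Theory.
Import numFieldNormedType.Exports.

Local Open Scope classical_set_scope.
Local Open Scope ring_scope.

Record dual (R : realType) (X : normedModType R) := Dual {
  dual_val :> {linear X -> R^o} ;
  dual_continuous : continuous dual_val }.

(* The carrier is X itself, so points and sets of X can be viewed in it. *)
Definition weak_topology (R : realType) (X : normedModType R) :
    topologicalType :=
  sup_topology (fun phi : dual X =>
    Topological.class (initial_topology (phi : X -> R^o))).

Definition weakly_compact (R : realType) (X : normedModType R) (C : set X) :=
  compact (C : set (weak_topology X)).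

Definition weakly_cvg (R : realType) (X : normedModType R)
    (x : nat -> X) (l : X) :=
  x n @[n --> \oo] --> (l : weak_topology X).

Definition weak_cauchy (R : realType) (X : normedModType R) (x : nat -> X) :=
  forall phi : dual X, cvgn (fun n => phi (x n)).

(* Sequences are indexed from 0: x 0 and y 0 are the first terms, so the
   partial sum paired with x n has n.+1 terms. *)
Definition property_u (R : realType) (X : normedModType R) :=
  forall x : nat -> X, weak_cauchy x ->
  exists y : nat -> X,
    (forall phi : dual X, (\sum_(0 <= n <oo) (`|phi (y n)|)%:E < +oo)%E) /\
    weakly_cvg (fun n => x n - \sum_(i < n.+1) y i) 0.

Definition bounded_closed_convex (R : realType) (X : normedModType R)
    (M : set X) : set (set X) :=
  [set K | [/\ K `<=` M, K !=set0, bounded_set K, closed K & convex_set K]].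

(* A self-map of K is represented by a total map f : X -> X preserving K; a
   class of mappings is a predicate of K and f, meant to depend only on the
   restriction of f to K. *)
Definition generic_FPP (R : realType) (X : normedModType R) (C : set X)
    (M : set X -> (X -> X) -> Prop) :=
  forall K : set X, bounded_closed_convex C K ->
  forall f : X -> X, set_fun K K f -> M K f -> exists2 x, K x & f x = x.

Definition uniformly_biLipschitz (R : realType) (X : normedModType R)
    (K : set X) (f : X -> X) :=
  exists c1 c2 : R, [/\ 0 < c1, 0 < c2 &
    forall (x y : X) (p : nat), K x -> K y -> (0 < p)%N ->
      c1 * `|x - y| <= `|iter p f x - iter p f y| <= c2 * `|x - y|].

Definition affine_on (R : realType) (X : normedModType R)
    (K : set X) (f : X -> X) :=
  forall (x y : X) (t : R), K x -> K y -> 0 <= t <= 1 ->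
    f (t *: x + (1 - t) *: y) = t *: f x + (1 - t) *: f y.

Definition theta (R : realType) (X : normedModType R)
    (K : set X) (f : X -> X) : \bar R :=
  ereal_inf [set limn_einf (fun n => (`|xy.1 - iter n f xy.2|)%:E)
            | xy in K `*` K].

(* Main.v *)
Require Import Defs.
From HB Require Import structures.
From mathcomp Require Import all_boot all_order all_algebra.
From mathcomp Require Import all_classical all_reals all_analysis.
From mathcomp Require Import ring lra zify.

(** If [C] is weakly compact, [K] is a closed convex subset of [C] and [f] is an
    affine Lipschitz self-map of [K], the Cesaro means of an orbit are moved by
    [f] by an amount tending to [0]. The points of [K] moved by at most [e] form
    a closed convex, hence weakly closed, set; a weak cluster point of the means
    belongs to all of these sets and is fixed ([weakly_compact_fixed_point]).

    Conversely, suppose that [C] is not weakly compact. The aim is a sequence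
    [z] in [C] such that the right shift [z i |-> z (i + 1)] and all its
    iterates are bi-Lipschitz on finite combinations of [z], with uniform
    constants, and such that the norm of a combination dominates every tail sum
    of its coefficients. Then the shift extends to the closed convex hull [K] of
    [z], and it pushes the mass [1] of every point of [K] to infinity, so that
    [theta > 0] and there is no fixed point ([shift_not_generic_FPP]).

    To find [z], take an ultrafilter on [C] without weak limit in [C]. It
    converges to an element [Phi] of the bidual that lies at positive distance
    from [X], as [X] is complete and [C] is weakly closed ([Phi_distance]).
    Helly's theorem, in the form of [far_from_points_small], provides
    functionals that are nearly zero at finitely many given points but not at
    [Phi]; alternating choices of functionals and points of [C] give a sequence
    [x] in [C] whose combinations have norm at least [d / 2] times any tail sum
    of the coefficients ([exists_james_sequence], [james_tail_le]), and this
    passes to subsequences. By Rosenthal's theorem ([rosenthal_l1]) there are two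
    cases.

    - Some sequence of points [x (g i)] is equivalent to the unit vector basis
      of l1; take it for [z] ([l1_sequence_not_generic_FPP]).
    - Some subsequence is weak Cauchy. Property (u) gives a weakly
      unconditionally Cauchy series [\sum_i y i] whose partial sums differ from
      the subsequence by a weakly null sequence. Convex blocks of this
      difference tend to [0] in norm as fast as desired, and the partial sums
      satisfy an upper estimate by the largest tail of the coefficients, by
      uniform boundedness. So convex blocks of the subsequence are equivalent to
      the summing basis of the space of null sequences, and can be taken for
      [z] ([convex_blocks_not_generic_FPP]). *)

Set Implicit Arguments.
Unset Strict Implicit.
Unset Printing Implicit Defensive.

Import Order.TTheory GRing.Theory Num.Theory.
Import numFieldNormedType.Exports.

Local Open Scope classical_set_scope.
Local Open Scope ring_scope.

(** * Dependent choice and Hahn-Banach separation *)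

(** Dependent choice in which every step may refer to all earlier choices; the
    constructions by induction below are instances of it. *)
Lemma history_choice (T : Type) (t0 : T) (P : seq T -> T -> Prop) :
  (forall l, (forall i, (i < size l)%N -> P (take i l) (nth t0 l i)) ->
    exists t, P l t) ->
  exists u : nat -> T, forall n, P (mkseq u n) (u n).
Proof.
move=> Pex.
pose next l :=
  if pselect (exists t, P l t) is left h then projT1 (cid h) else t0.
have nextP l : (exists t, P l t) -> P l (next l).
  by rewrite /next; case: pselect => // h _; exact: projT2 (cid h).
pose build := fix build n :=
  if n is n'.+1 then rcons (build n') (next (build n')) else [::].
pose u n := next (build n).
have buildE n : build n = mkseq u n.
  by elim: n => //= n IH; rewrite mkseqS -IH.
exists u => n; rewrite -buildE.
have [m] := ubnP n; elim: m n => // m IH n; rewrite ltnS => nm.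
apply: nextP; apply: Pex => i.
rewrite buildE size_mkseq => ilt; rewrite nth_mkseq// -map_take take_iota.
rewrite (minn_idPl (ltnW ilt)) -/(mkseq u i) -buildE.
by apply: IH; exact: leq_trans nm.
Qed.

Section hahn_banach.
Variables (R : realType) (X : lmodType R).
Implicit Types (p q : X -> R) (x y v : X).

Definition sublinear p :=
  (forall x y, p (x + y) <= p x + p y) /\
  (forall t x, 0 <= t -> p (t *: x) = t * p x).

Lemma sublinear_le p : p 0 = 0 -> (forall x y, p (x + y) <= p x + p y) ->
  (forall t x, 0 < t -> p (t *: x) <= t * p x) -> sublinear p.
Proof.
move=> p0 pD pZ; split=> // t x; rewrite le_eqVlt => /predU1P[<-|t0].
  by rewrite scale0r mul0r.
apply/eqP; rewrite eq_le pZ//= -ler_pdivlMl//.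
by apply: le_trans (pZ _ _ _); rewrite ?invr_gt0// scalerA mulVf ?gt_eqF// scale1r.
Qed.

Lemma sublinear0 p : sublinear p -> p 0 = 0.
Proof. by move=> [_ pZ]; rewrite -(scale0r 0) pZ// mul0r. Qed.

Lemma sublinear_geN p x : sublinear p -> - p (- x) <= p x.
Proof.
move=> p_; have := p_.1 x (- x); rewrite subrr sublinear0//; lra.
Qed.

Let inf_set_prop (S : set R) (b : R) : S !=set0 -> lbound S b ->
  (forall s, S s -> inf S <= s) /\ b <= inf S.
Proof.
move=> S0 bS; split; last exact: lb_le_inf.
by move=> s Ss; apply: ge_inf => //; exists b.
Qed.

(** The infimum of a chain is again sublinear because, of two members of the
    chain nearly attaining it at two points, the smaller one nearly attains it
    at both. *)
Lemma minimal_sublinear p : sublinear p ->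
  exists q, [/\ sublinear q, forall x, q x <= p x &
    forall q', sublinear q' -> (forall x, q' x <= q x) -> q' = q].
Proof.
move=> p_; pose T := {q | sublinear q /\ forall x, q x <= p x}.
pose below (q q' : T) := `[< forall x, sval q' x <= sval q x >].
have pT : sublinear p /\ forall x, p x <= p x by [].
have [||A Atot|] := @ZL_preorder T (exist _ p pT) below.
- by move=> t; apply/asboolP.
- move=> r s t /asboolP rs /asboolP st; apply/asboolP => x.
  exact: le_trans (st x) (rs x).
- have [[q0 Aq0]|A0] := pselect (A !=set0); last first.
    by exists (exist _ p pT) => s As; case: A0; exists s.
  pose V x := [set sval q x | q in A].
  have V0 x : V x !=set0 by exists (sval q0 x), q0.
  have Vlb x : lbound (V x) (- p (- x)).
    move=> _ [[q [q_ qp]] _ <-] /=; apply: le_trans (sublinear_geN _ q_).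
    by rewrite lerN2.
  have Vle x (q : T) : A q -> inf (V x) <= sval q x.
    by move=> Aq; apply: (inf_set_prop (V0 x) (Vlb x)).1; exists q.
  have Vge x b : (forall q : T, A q -> b <= sval q x) -> b <= inf (V x).
    by move=> Ab; apply: lb_le_inf => // _ [q Aq <-]; exact: Ab.
  have infV : sublinear (fun x => inf (V x)).
    apply: sublinear_le.
    + apply/eqP; rewrite eq_le; apply/andP; split.
        by apply: le_trans (Vle _ _ Aq0) _; rewrite (sublinear0 (svalP q0).1).
      by apply: (Vge) => q Aq; rewrite (sublinear0 (svalP q).1).
    + move=> x y; rewrite -lerBlDr; apply: (Vge) => q Aq.
      rewrite lerBlDr -lerBlDl; apply: (Vge) => q' Aq'; rewrite lerBlDl.
      have [/asboolP|/asboolP] := Atot _ _ Aq Aq' => qq.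
        apply: le_trans (Vle _ _ Aq') _; apply: le_trans ((svalP q').1.1 _ _) _.
        by rewrite lerD2r.
      apply: le_trans (Vle _ _ Aq) _; apply: le_trans ((svalP q).1.1 _ _) _.
      by rewrite lerD2l.
    + move=> t x t0; rewrite -ler_pdivrMl//; apply: (Vge) => q Aq.
      rewrite ler_pdivrMl// -((svalP q).1.2 _ _ (ltW t0)); exact: Vle.
  have infp x : inf (V x) <= p x.
    exact: le_trans (Vle _ _ Aq0) ((svalP q0).2 _).
  exists (exist (fun q => sublinear q /\ forall x, q x <= p x) _
    (conj infV infp)).
  move=> q Aq; apply/asboolP => x /=; exact: Vle.
- move=> [q [q_ qp]] /= qmin; exists q; split=> // q' q'_ q'q.
  have q'p x : q' x <= p x by exact: le_trans (q'q x) (qp x).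
  have /asboolP/= := qmin (exist _ q' (conj q'_ q'p)) (asboolT q'q).
  by move=> h; apply/funext => x; apply/eqP; rewrite eq_le q'q h.
Qed.

(** If [q] is minimal, the sublinear function
    [x |-> inf_(t >= 0) (q (x + t y) - t q y)] below it equals it, and its
    value at [- y] is at most [- q y] (take [t = 1]): so [q] is odd. *)
Lemma minimal_sublinear_odd q : sublinear q ->
  (forall q', sublinear q' -> (forall x, q' x <= q x) -> q' = q) ->
  forall y, q (- y) = - q y.
Proof.
move=> q_ qmin y; have [qD qZ] := q_.
pose V x := [set r | exists2 t, 0 <= t & r = q (x + t *: y) - t * q y].
have V0 x : V x !=set0 by exists (q (x + 0 *: y) - 0 * q y), 0.
have Vlb x : lbound (V x) (- q (- x)).
  move=> _ [t t0 ->]; have := qD (x + t *: y) (- x).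
  rewrite addrAC subrr add0r (qZ _ _ t0); lra.
have Vle x t : 0 <= t -> inf (V x) <= q (x + t *: y) - t * q y.
  by move=> t0; apply: (inf_set_prop (V0 x) (Vlb x)).1; exists t.
have Vge x b : (forall t, 0 <= t -> b <= q (x + t *: y) - t * q y) ->
    b <= inf (V x).
  by move=> h; apply: lb_le_inf => // _ [t t0 ->]; exact: h.
have VE : (fun x => inf (V x)) = q.
  apply: qmin => [|x]; last first.
    by have := Vle x _ (lexx 0); rewrite scale0r addr0 mul0r subr0.
  apply: sublinear_le.
  - apply/eqP; rewrite eq_le; apply/andP; split.
      by have := Vle 0 _ (lexx 0); rewrite scale0r addr0 mul0r subr0 sublinear0.
    by apply: (Vge) => t t0; rewrite add0r qZ// subrr.
  - move=> x1 x2; rewrite -lerBlDr; apply: (Vge) => t1 t10.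
    rewrite lerBlDr -lerBlDl; apply: (Vge) => t2 t20; rewrite lerBlDl.
    apply: le_trans (Vle _ _ (addr_ge0 t10 t20)) _.
    have := qD (x1 + t1 *: y) (x2 + t2 *: y).
    by rewrite addrACA -scalerDl; lra.
  - move=> s x s0; rewrite -ler_pdivrMl//; apply: (Vge) => t t0.
    rewrite ler_pdivrMl//.
    apply: le_trans (Vle _ _ (mulr_ge0 (ltW s0) t0)) _.
    by rewrite -scalerA -scalerDr (qZ _ _ (ltW s0)) mulrBr mulrA.
apply/eqP; rewrite eq_le; apply/andP; split.
  have := Vle (- y) 1 ler01; rewrite scale1r addNr sublinear0// mul1r sub0r.
  by rewrite (congr1 (fun g => g (- y)) VE).
have := sublinear_geN (- y) q_; rewrite opprK; lra.
Qed.

(** The Hahn-Banach theorem, for an extension of the zero functional on the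
    zero subspace: a minimal sublinear function below [p] is linear, being
    subadditive and odd. *)
Lemma sublinear_dominates p : sublinear p ->
  exists phi : X -> R,
    (forall a x y, phi (a *: x + y) = a * phi x + phi y) /\
    forall x, phi x <= p x.
Proof.
move=> /minimal_sublinear[q [q_ qp /minimal_sublinear_odd qN]].
have {}qN := qN q_; exists q; split=> //.
have qD x y : q (x + y) = q x + q y.
  apply/eqP; rewrite eq_le q_.1/=.
  by have := q_.1 (- x) (- y); rewrite -opprD !qN; lra.
move=> a x y; rewrite qD; congr (_ + _).
have [/q_.2//|a0] := leP 0 a.
by rewrite -[a]opprK scaleNr qN q_.2 ?mulNr// oppr_ge0 ltW.
Qed.

End hahn_banach.

Section dual_ball.
Variables (R : realType) (X : normedModType R).
Implicit Types (phi psi : X -> R) (x y : X) (D : set X) (c : R).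

(** Functionals are plain functions here, so that combinations and pointwise
    limits of functionals need no repackaging. *)
Definition dual_ball c : set (X -> R) := [set phi |
  (forall a x y, phi (a *: x + y) = a * phi x + phi y) /\
  forall x, `|phi x| <= c * `|x|].

Section dual_ball_theory.
Variables (c : R) (phi : X -> R).
Hypothesis phic : dual_ball c phi.

Lemma dual_ballD x y : phi (x + y) = phi x + phi y.
Proof. by have := phic.1 1 x y; rewrite scale1r mul1r. Qed.

Lemma dual_ball0 : phi 0 = 0.
Proof. by have := dual_ballD 0 0; rewrite addr0; lra. Qed.

Lemma dual_ballZ a x : phi (a *: x) = a * phi x.
Proof. by have := phic.1 a x 0; rewrite !addr0 dual_ball0 addr0. Qed.

Lemma dual_ballN x : phi (- x) = - phi x.
Proof. by rewrite -scaleN1r dual_ballZ mulN1r. Qed.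

Lemma dual_ballB x y : phi (x - y) = phi x - phi y.
Proof. by rewrite dual_ballD dual_ballN. Qed.

Lemma dual_ball_sum (I : Type) (r : seq I) (P : pred I) (F : I -> X) :
  phi (\sum_(i <- r | P i) F i) = \sum_(i <- r | P i) phi (F i).
Proof.
by elim/big_rec2: _ => [|i u v _ <-]; [exact: dual_ball0|exact: dual_ballD].
Qed.

End dual_ball_theory.

Lemma dual_ball_comb c c' a b phi psi : dual_ball c phi -> dual_ball c' psi ->
  dual_ball (`|a| * c + `|b| * c') (fun x => a * phi x + b * psi x).
Proof.
move=> phic psic; split=> [t x y|x]; first by rewrite phic.1 psic.1; ring.
apply: le_trans (ler_normD _ _) _; rewrite !normrM mulrDl -!mulrA.
by apply: lerD; apply: ler_wpM2l => //; [exact: phic.2|exact: psic.2].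
Qed.

Lemma dual_ballW c c' phi : c <= c' -> dual_ball c phi -> dual_ball c' phi.
Proof.
move=> cc [phiL phic]; split=> // x.
by apply: le_trans (phic x) _; exact: ler_wpM2r.
Qed.

Lemma dual_ball_conv t phi psi :
  0 <= t <= 1 -> dual_ball 1 phi -> dual_ball 1 psi ->
  dual_ball 1 (fun x => t * phi x + (1 - t) * psi x).
Proof.
move=> /andP[t0 t1] phi1 psi1.
apply: dual_ballW (dual_ball_comb t (1 - t) phi1 psi1).
by rewrite !ger0_norm ?subr_ge0//; lra.
Qed.

Lemma dual_ball_opp phi : dual_ball 1 phi -> dual_ball 1 (fun x => - phi x).
Proof.
move=> phi1; split=> [a x y|x]; first by rewrite phi1.1; ring.
by rewrite normrN; exact: phi1.2.
Qed.

Definition convex_comb_closed D :=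
  forall x y (t : R), D x -> D y -> 0 <= t <= 1 -> D (t *: x + (1 - t) *: y).

(** A functional lies below [v |-> inf (|v + t (d - x)| - t r)], the infimum
    being over [t >= 0] and [d] in [D], only if it has norm at most [1] and is
    at least [r] on [D - x]. *)
Lemma separation D x0 (r : R) : D !=set0 -> convex_comb_closed D ->
  (forall d, D d -> r <= `|d - x0|) ->
  exists2 phi, dual_ball 1 phi & forall d, D d -> r <= phi (d - x0).
Proof.
move=> [d0 Dd0] Dconv Dr.
pose V v := [set s | exists t d, [/\ 0 <= t, D d &
  s = `|v + t *: (d - x0)| - t * r]].
have V0 v : V v !=set0.
  by exists (`|v + 0 *: (d0 - x0)| - 0 * r), 0, d0.
have Vlb v : lbound (V v) (- `|v|).
  move=> _ [t [d [t0 Dd ->]]]; have := ler_normB (v + t *: (d - x0)) v.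
  rewrite addrAC subrr add0r normrZ ger0_norm//.
  have := ler_wpM2l t0 (Dr _ Dd); lra.
have Vle v t d : 0 <= t -> D d -> inf (V v) <= `|v + t *: (d - x0)| - t * r.
  by move=> t0 Dd; apply: ge_inf; [exists (- `|v|)|exists t, d].
have Vge v b :
    (forall t d, 0 <= t -> D d -> b <= `|v + t *: (d - x0)| - t * r) ->
    b <= inf (V v).
  by move=> h; apply: lb_le_inf => // _ [t [d [t0 Dd ->]]]; exact: h.
have Vnorm v : inf (V v) <= `|v|.
  by have := Vle v _ _ (lexx 0) Dd0; rewrite scale0r addr0 mul0r subr0.
have Vsub : sublinear (fun v => inf (V v)).
  apply: sublinear_le.
  - apply/eqP; rewrite eq_le; apply/andP; split.
      by apply: le_trans (Vnorm _) _; rewrite normr0.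
    apply: (Vge) => t d t0 Dd; rewrite add0r normrZ ger0_norm// -mulrBr.
    by rewrite mulr_ge0// subr_ge0 Dr.
  - move=> v1 v2; rewrite -lerBlDr; apply: (Vge) => t1 d1 t10 Dd1.
    rewrite lerBlDr -lerBlDl; apply: (Vge) => t2 d2 t20 Dd2; rewrite lerBlDl.
    have [t0|t0] := eqVneq (t1 + t2) 0.
      have [-> ->] : t1 = 0 /\ t2 = 0 by split; lra.
      rewrite !scale0r !addr0 !mul0r !subr0.
      exact: le_trans (Vnorm _) (ler_normD _ _).
    have tp : 0 < t1 + t2 by rewrite lt_neqAle eq_sym t0 addr_ge0.
    pose s := t1 / (t1 + t2).
    have s01 : 0 <= s <= 1.
      by rewrite divr_ge0 ?addr_ge0//= ler_pdivrMr// mul1r lerDl.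
    apply: le_trans (Vle _ _ _ (ltW tp) (Dconv _ _ _ Dd1 Dd2 s01)) _.
    have -> : (t1 + t2) *: (s *: d1 + (1 - s) *: d2 - x0) =
        t1 *: (d1 - x0) + t2 *: (d2 - x0).
      rewrite !scalerBr scalerDr !scalerA.
      have -> : (t1 + t2) * s = t1 by rewrite /s mulrC divfK.
      have -> : (t1 + t2) * (1 - s) = t2.
        by rewrite mulrBr mulr1 /s [X in _ - X]mulrC divfK//; ring.
      by rewrite scalerDl opprD addrACA.
    have := ler_normD (v1 + t1 *: (d1 - x0)) (v2 + t2 *: (d2 - x0)).
    by rewrite addrACA; lra.
  - move=> s v s0; rewrite -ler_pdivrMl//; apply: (Vge) => t d t0 Dd.
    rewrite ler_pdivrMl//.
    apply: le_trans (Vle _ _ _ (mulr_ge0 (ltW s0) t0) Dd) _.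
    by rewrite -scalerA -scalerDr normrZ gtr0_norm// mulrBr mulrA.
have [phi [phiL phile]] := sublinear_dominates Vsub.
have phi1 v : phi v <= `|v| by exact: le_trans (phile v) (Vnorm v).
have phi0 : phi 0 = 0 by have := phiL 1 0 0; rewrite scaler0 addr0 mul1r; lra.
have phiN v : phi (- v) = - phi v.
  by have := phiL (-1) v 0; rewrite !addr0 scaleN1r phi0 addr0 mulN1r.
exists phi.
  split=> // v; rewrite mul1r ler_norml phi1 andbT.
  by rewrite -[leRHS]opprK lerN2 -phiN -normrN phi1.
move=> d Dd; have := phile (- (d - x0)); rewrite phiN => h.
have := le_trans h (Vle _ _ _ ler01 Dd).
by rewrite scale1r addNr normr0 mul1r; lra.
Qed.

Lemma dual_norming x : exists2 phi, dual_ball 1 phi & phi x = `|x|.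
Proof.
have [|y z t -> -> _|_ ->|phi phi1 /(_ _ erefl)] :=
    @separation [set x] 0 `|x|.
- by exists x.
- by rewrite /= -scalerDl addrC subrK scale1r.
- by rewrite subr0.
rewrite subr0 => phix; exists phi => //; apply/eqP; rewrite eq_le phix andbT.
by have := phi1.2 x; rewrite mul1r; apply: le_trans; exact: ler_norm.
Qed.

Lemma norm_le_dual x c :
  (forall phi, dual_ball 1 phi -> phi x <= c) -> `|x| <= c.
Proof. by move=> h; have [phi /h + <-] := dual_norming x. Qed.

(** A ball around [x] missing [D] bounds the distance from [x] to [D] from
    below, which is what [separation] requires; thus a closed convex set is
    weakly closed. *)
Lemma closed_separation D x : D !=set0 -> closed D -> convex_comb_closed D ->
  ~ D x -> exists phi (r : R), [/\ dual_ball 1 phi, 0 < r &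
    forall d, D d -> phi x + r <= phi d].
Proof.
move=> D0 Dcl Dconv nDx.
have /nbhs_ballP[r /= r0 rD] : nbhs x (~` D).
  by apply: open_nbhs_nbhs; split=> //; exact: closed_openC.
have [d Dd|phi phi1 phir] := @separation D x r D0 Dconv.
  rewrite leNgt; apply/negP => dr; apply: (rD d) => //.
  by rewrite -ball_normE /= -normrN opprB.
exists phi, r; split=> // d /phir; rewrite (dual_ballB phi1); lra.
Qed.

End dual_ball.

(** * Weak compactness gives fixed points *)

Section weak_topology_theory.
Variables (R : realType) (X : normedModType R).
Implicit Types (x y : X) (D : set X).

Lemma convex_setP (A : set X) : convex_set A -> convex_comb_closed A.
Proof.
move=> Aconv x y t Ax Ay /andP[t0 t1].
have t01 : Itv.spec (@Itv.num_sem R) (Itv.Real `[0%Z, 1%Z]) t.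
  by apply/and3P; split; rewrite ?ger0_real//= bnd_simp.
by have := Aconv x y (Itv.mk t01); rewrite !inE; exact.
Qed.

Lemma convex_comb_closedP (A : set X) : convex_comb_closed A -> convex_set A.
Proof.
move=> Aconv x y t; rewrite !inE => Ax Ay.
by apply: Aconv => //; rewrite ge0 le1.
Qed.

Lemma dual_of_ball c (phi : X -> R) : dual_ball c phi ->
  exists f : dual X, forall x, f x = phi x.
Proof.
move=> phic.
have phiL : linear (phi : X -> R^o) by move=> a x y; exact: phic.1.
pose g : {linear X -> R^o} := HB.pack (phi : X -> R^o)
  (GRing.isLinear.Build R X R^o *:%R phi phiL).
suff cg : continuous g by exists (Dual cg).
apply: bounded_linear_continuous; apply/linear_boundedP.
exists c; split=> [|r cr x]; first exact: num_real.
apply: le_trans (phic.2 x) _; exact: ler_wpM2r (ltW cr).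
Qed.

Lemma ball_of_dual (f : dual X) : exists2 c, 0 < c & dual_ball c (f : X -> R).
Proof.
have /linear_bounded_continuous/linear_boundedP := @dual_continuous _ _ f.
move=> /pinfty_ex_gt0[c c0 fc]; exists c => //; split=> // a x y.
by rewrite linearP.
Qed.

(** The weak topology is the supremum of the topologies induced by the
    functionals, so weak convergence is tested by one functional at a time. *)
Lemma weak_cvgP (F : set_system X) (l : X) : Filter F ->
  (F --> (l : weak_topology X)) <-> (forall f : dual X, f x @[x --> F] --> f l).
Proof.
move=> FF; split=> [/cvg_sup Fl f|Fl].
  have {}Fl : F --> (l : initial_topology (f : X -> R^o)) := Fl f.
  move=> A Al; apply: Fl.
  exact: (@initial_continuous X R^o (f : X -> R^o) l).
apply/cvg_sup => f A; rewrite nbhsE => -[_ [[B Bo <-] Bl] BA].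
have : F (f @^-1` B) by apply: Fl; exact: open_nbhs_nbhs.
exact: filterS.
Qed.

Lemma weak_cvg_ball (F : set_system X) (l : X) c (phi : X -> R) : Filter F ->
  F --> (l : weak_topology X) -> dual_ball c phi -> phi x @[x --> F] --> phi l.
Proof.
move=> FF /weak_cvgP Fl /dual_of_ball[f fE].
by rewrite -fE; under eq_fun do rewrite -fE; exact: Fl.
Qed.

Lemma ball_weak_cvg (F : set_system X) (l : X) : Filter F ->
  (forall phi, dual_ball 1 phi -> phi x @[x --> F] --> phi l) ->
  F --> (l : weak_topology X).
Proof.
move=> FF Fl; apply/weak_cvgP => f; have [c c0 fc] := ball_of_dual f.
have fE x : c * (c^-1 * f x) = f x by rewrite mulrA mulfV ?gt_eqF// mul1r.
suff : (c * (c^-1 * f x) : R^o) @[x --> F] --> (c * (c^-1 * f l) : R^o).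
  by rewrite fE; under eq_fun do rewrite fE.
apply: cvgMr; apply: (Fl (fun x => c^-1 * f x)).
split=> [a x y|x]; first by rewrite fc.1; ring.
rewrite normrM gtr0_norm ?invr_gt0// mul1r ler_pdivrMl//; exact: fc.2.
Qed.

(** A functional separating [z] from [D] strictly would keep the tail of the
    sequence out of a weak neighbourhood of [z]. *)
Lemma weak_cluster_closed_convex D (x : nat -> X) (z : X) : closed D ->
  convex_comb_closed D -> (\forall n \near \oo, D (x n)) ->
  cluster (x n @[n --> \oo] : set_system (weak_topology X)) z -> D z.
Proof.
move=> Dcl Dconv [N _ Dx] xz; apply: contrapT => nDz.
have D0 : D !=set0 by exists (x N); exact: Dx (leqnn N).
have [phi [r [phi1 r0 phir]]] := closed_separation D0 Dcl Dconv nDz.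
have phiz : nbhs (z : weak_topology X) [set y : X | phi y < phi z + r].
  have /(_ _) := @weak_cvg_ball _ z 1 phi (@nbhs_filter (weak_topology X) z).
  move=> /(_ cvg_id phi1) /(_ [set s | s < phi z + r]); apply.
  by apply: lt_nbhsl; rewrite ltrDl.
have [y [/= Dy yz]] : D `&` [set y | phi y < phi z + r] !=set0.
  apply: (xz D _ _ phiz).
  by exists N.
by have := phir _ Dy; rewrite leNgt yz.
Qed.

End weak_topology_theory.

Section affine_fixed_point.
Variables (R : realType) (X : normedModType R) (K : set X) (f : X -> X).
Hypotheses (Kconv : convex_comb_closed K) (fK : set_fun K K f)
  (faff : affine_on K f).

Lemma iter_in x n : K x -> K (iter n f x).
Proof. by move=> Kx; elim: n => //= n; exact: fK. Qed.

(** The Cesaro means of an orbit: [f] moves the [n]-th one by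
    [(f^n x - x) / n]. *)
Lemma cesaro_mean x n : K x -> exists2 a, K a &
  f a - a = n.+1%:R^-1 *: (iter n.+1 f x - x).
Proof.
move=> Kx; elim: n => [|n [a Ka fa]].
  by exists x => //; rewrite invr1 scale1r.
pose t : R := n.+1%:R / n.+2%:R.
have n2 : n.+2%:R != 0 :> R by rewrite pnatr_eq0.
have n1 : n.+1%:R != 0 :> R by rewrite pnatr_eq0.
have t01 : 0 <= t <= 1 by rewrite divr_ge0//= ler_pdivrMr// mul1r ler_nat.
have tE : 1 - t = n.+2%:R^-1.
  by rewrite /t -[X in X - _](mulfV n2) -mulrBl -natrB// subSnn mul1r.
exists (t *: a + (1 - t) *: iter n.+1 f x); first by apply: Kconv => //; exact: iter_in.
rewrite faff//; last exact: iter_in.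
rewrite opprD addrACA -!scalerBr fa scalerA tE.
have -> : t * n.+1%:R^-1 = n.+2%:R^-1 by rewrite /t mulrAC mulfV// mul1r.
by rewrite -scalerDr addrC subrKA.
Qed.

Lemma approximate_fixed_point e : K !=set0 -> bounded_set K -> 0 < e ->
  exists2 a, K a & `|f a - a| <= e.
Proof.
move=> [x Kx] /pinfty_ex_gt0[M M0 KM] e0.
have [n] : exists n : nat, M + M < n.+1%:R * e.
  exists (Num.truncn ((M + M) / e)); rewrite -ltr_pdivrMr//; exact: truncnS_gt.
rewrite mulrC -ltr_pdivrMr// => nM; have [a Ka fa] := cesaro_mean n Kx.
exists a => //; rewrite fa normrZ ger0_norm ?invr_ge0//.
rewrite mulrC; apply: le_trans (ltW nM); apply: ler_wpM2r => //.
apply: le_trans (ler_normB _ _) _.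
by apply: lerD; apply: KM => //; exact: iter_in.
Qed.

(** The points moved by at most [e] form a closed convex set, so a weak cluster
    point of approximate fixed points is fixed. *)
Lemma weakly_compact_fixed_point (C : set X) c : weakly_compact C -> K `<=` C ->
  closed K -> K !=set0 -> bounded_set K ->
  (forall x y, K x -> K y -> `|f x - f y| <= c * `|x - y|) ->
  exists2 x, K x & f x = x.
Proof.
move=> Ccpt KC Kcl K0 Kbd flip.
have c0 : 0 < `|c| + 1 + 1 by rewrite -addrA ltr_wpDl.
pose F e : set X := [set x | K x /\ `|f x - x| <= e].
have Fconv e : convex_comb_closed (F e).
  move=> x y t [Kx fx] [Ky fy] /andP[t0 t1]; split; first exact/Kconv/andP.
  rewrite faff ?t0// opprD addrACA -!scalerBr.
  apply: le_trans (ler_normD _ _) _; rewrite !normrZ !ger0_norm ?subr_ge0//.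
  have : t * `|f x - x| <= t * e by exact: ler_wpM2l.
  have : (1 - t) * `|f y - y| <= (1 - t) * e by rewrite ler_wpM2l ?subr_ge0.
  lra.
have Fcl e : closed (F e).
  move=> x clx; have Kx : K x.
    by apply: Kcl => B /clx[y [[Ky _] By]]; exists y.
  split=> //; apply/ler_addgt0Pl => d d0.
  have d'0 : 0 < d / (`|c| + 1 + 1) by rewrite divr_gt0.
  have [y [[Ky fy] xy]] := clx _ (nbhsx_ballx x _ d'0).
  move: xy; rewrite -ball_normE /= ltr_pdivlMr// => xy.
  have := flip _ _ Kx Ky; have := ler_normD (f x - f y) (f y - x).
  have := ler_normD (f y - y) (y - x); rewrite !addrA !subrK (distrC y x).
  have : c * `|x - y| <= `|c| * `|x - y| by rewrite ler_wpM2r// ler_norm.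
  have := normr_ge0 (x - y); lra.
have Fx n : exists x, F n.+1%:R^-1 x.
  by have [|a Ka fa] := @approximate_fixed_point n.+1%:R^-1 K0 Kbd; last exists a.
have [x xF] := choice Fx.
have [z [Cz xz]] : C `&` cluster (x n @[n --> \oo] : set_system (weak_topology X)) !=set0.
  by apply: Ccpt; exists 0%N => // n _ /=; apply: KC; have [] := xF n.
have Fz n : F n.+1%:R^-1 z.
  apply: weak_cluster_closed_convex xz; [exact: Fcl|exact: Fconv|].
  exists n => // m /= nm; have [Km fm] := xF m; split=> //.
  by apply: le_trans fm _; rewrite lef_pV2 ?posrE// ler_nat.
exists z; first by have [] := Fz 0%N.
apply/eqP; rewrite -subr_eq0 -normr_le0; apply/ler_addgt0Pl => e e0.
rewrite addr0; have [_] := Fz (Num.truncn e^-1); move/le_trans; apply.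
by rewrite invf_ple ?posrE// ltW// truncnS_gt.
Qed.

End affine_fixed_point.

(** * Combinations of a sequence and the shift on its closed convex hull *)

Section poly_combination.
Variables (R : realType) (X : lmodType R).
Implicit Types (x z : nat -> X) (a b : {poly R}).

(** Finitely supported coefficient sequences are encoded as polynomials: sums
    need no padding to a common length, and multiplication by ['X^p] shifts the
    coefficients by [p]. *)
Definition comb x a : X := \sum_(i < size a) a`_i *: x i.

Lemma comb_widen x a n : (size a <= n)%N -> comb x a = \sum_(i < n) a`_i *: x i.
Proof.
move=> an; rewrite /comb (big_ord_widen n (fun i => a`_i *: x i) an) big_mkcond.
apply: eq_bigr => i _; case: ltnP => // ai.
by rewrite nth_default// scale0r.
Qed.

Lemma comb_linear x t a b : comb x (t *: a + b) = t *: comb x a + comb x b.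
Proof.
pose n := maxn (size (t *: a + b)) (maxn (size a) (size b)).
rewrite !(@comb_widen _ _ n) ?leq_max ?leqnn ?orbT//.
rewrite scaler_sumr -big_split/=; apply: eq_bigr => i _.
by rewrite coefD coefZ scalerDl scalerA.
Qed.

Lemma combD x a b : comb x (a + b) = comb x a + comb x b.
Proof. by have := comb_linear x 1 a b; rewrite !scale1r. Qed.

Lemma comb0 x : comb x 0 = 0.
Proof. by rewrite /comb size_poly0 big_ord0. Qed.

Lemma combZ x t a : comb x (t *: a) = t *: comb x a.
Proof. by have := comb_linear x t a 0; rewrite comb0 !addr0. Qed.

Lemma combB x a b : comb x (a - b) = comb x a - comb x b.
Proof. by rewrite combD -[- b]scaleN1r combZ scaleN1r. Qed.

Lemma comb_sum x (I : Type) (r : seq I) (F : I -> {poly R}) :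
  comb x (\sum_(i <- r) F i) = \sum_(i <- r) comb x (F i).
Proof. by elim/big_rec2: _ => [|i u v _ <-]; [exact: comb0|exact: combD]. Qed.

Lemma comb_mulXn x p a : comb x ('X^p * a) = comb (fun i => x (p + i)%N) a.
Proof.
have [->|a0] := eqVneq a 0; first by rewrite mulr0 !comb0.
have sz : (size ('X^p * a)%R <= p + size a)%N by rewrite -commr_polyXn size_mulXn.
rewrite (comb_widen x sz) big_split_ord/= big1 ?add0r => [|i _].
  by apply: eq_bigr => i _; rewrite coefXnM ltnNge leq_addr/= addKn.
by rewrite coefXnM ltn_ord scale0r.
Qed.

End poly_combination.

Section tail_theory.
Variable (R : realType).
Implicit Types (a b : {poly R}).

(** Written as a combination of scalars [0] and [1], so that the linearity and
    shift lemmas for [comb] apply. *)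
Definition tail k a : R := comb (fun i => (k <= i)%:R : R^o) a.

Definition convex_poly a := (forall i, 0 <= a`_i) /\ tail 0 a = 1.

Lemma tailE k a : tail k a = \sum_(i < size a) a`_i * (k <= i)%:R.
Proof. by []. Qed.

Lemma tail_widen k a n : (size a <= n)%N ->
  tail k a = \sum_(i < n) a`_i * (k <= i)%:R.
Proof. exact: (@comb_widen R R^o). Qed.

Lemma tailD k a b : tail k (a + b) = tail k a + tail k b.
Proof. exact: (@combD R R^o). Qed.

Lemma tailB k a b : tail k (a - b) = tail k a - tail k b.
Proof. exact: (@combB R R^o). Qed.

Lemma tailZ k t a : tail k (t *: a) = t * tail k a.
Proof. exact: (@combZ R R^o). Qed.

Lemma tail_mulXn k p a : tail k ('X^p * a) = tail (k - p)%N a.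
Proof.
rewrite /tail comb_mulXn; apply: eq_bigr => i _.
by congr (_ *: (_)%:R); rewrite leq_subLR.
Qed.

Lemma tail_oversize k a : (size a <= k)%N -> tail k a = 0.
Proof.
move=> ak; rewrite tailE big1// => i _.
by rewrite leqNgt (leq_trans (ltn_ord i) ak)/= mulr0.
Qed.

Lemma tailS k a : tail k a = a`_k + tail k.+1 a.
Proof.
rewrite !(@tail_widen _ a (maxn (size a) k.+1)) ?leq_max ?leqnn//.
have kn : (k < maxn (size a) k.+1)%N by rewrite leq_max ltnSn orbT.
rewrite (bigD1 (Ordinal kn))//= leqnn mulr1 [in RHS](bigD1 (Ordinal kn))//=.
rewrite ltnn mulr0 add0r; congr (_ + _); apply: eq_bigr => i ik.
have {}ik : k != i by apply: contraNneq ik => ki; apply/eqP/val_inj.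
by rewrite ltn_neqAle ik.
Qed.

Lemma convex_poly_shift p a : convex_poly a -> convex_poly ('X^p * a).
Proof.
move=> [a0 a1]; split=> [i|]; last by rewrite tail_mulXn sub0n.
by rewrite coefXnM; case: ifP.
Qed.

Lemma convex_poly_conv t a b : 0 <= t <= 1 -> convex_poly a -> convex_poly b ->
  convex_poly (t *: a + (1 - t) *: b).
Proof.
move=> /andP[t0 t1] [a0 a1] [b0 b1]; split=> [i|].
  by rewrite coefD !coefZ addr_ge0// mulr_ge0// subr_ge0.
by rewrite tailD !tailZ a1 b1 !mulr1 addrC subrK.
Qed.

Lemma convex_poly1 : convex_poly (1 : {poly R}).
Proof.
split=> [i|]; first by rewrite coef1 ler0n.
by rewrite tailE size_poly1 big_ord_recl big_ord0 coef1 mul1r addr0.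
Qed.

Lemma tail_convex k a : convex_poly a -> 0 <= tail k a <= 1.
Proof.
move=> [a0 <-]; rewrite !tailE; apply/andP; split.
  by apply: sumr_ge0 => i _; rewrite mulr_ge0.
by apply: ler_sum => i _; rewrite ler_wpM2l// ler_nat; case: (k <= i)%N.
Qed.

Lemma norm_coef_tail a T i : (forall k, `|tail k a| <= T) -> `|a`_i| <= 2 * T.
Proof.
move=> aT; have -> : a`_i = tail i a - tail i.+1 a by rewrite tailS addrK.
apply: le_trans (ler_normB _ _) _; have := aT i; have := aT i.+1; lra.
Qed.

Lemma norm_tail_l1 k a : `|tail k a| <= \sum_(i < size a) `|a`_i|.
Proof.
rewrite tailE; apply: le_trans (ler_norm_sum _ _ _) _; apply: ler_sum => i _.
by rewrite normrM normr_nat ler_piMr// lern1; case: (k <= i)%N.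
Qed.

Lemma sum_norm_mulXn p a :
  \sum_(i < size ('X^p * a)) `|('X^p * a)`_i| = \sum_(i < size a) `|a`_i|.
Proof.
have [->|a0] := eqVneq a 0; first by rewrite mulr0.
have -> : size ('X^p * a)%R = (p + size a)%N by rewrite -commr_polyXn size_mulXn.
rewrite big_split_ord/= big1 ?add0r => [|i _].
  by apply: eq_bigr => i _; rewrite coefXnM ltnNge leq_addr/= addKn.
by rewrite coefXnM ltn_ord normr0.
Qed.

End tail_theory.

Lemma convex_comb_in (R : realType) (X : normedModType R) (A : set X)
    (z : nat -> X) (a : {poly R}) : convex_comb_closed A -> (forall i, A (z i)) ->
  convex_poly a -> A (comb z a).
Proof.
move=> Aconv Az [a0 a1].
have H n : 0 < \sum_(i < n) a`_i ->
    A ((\sum_(i < n) a`_i)^-1 *: \sum_(i < n) a`_i *: z i).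
  elim: n => [|n IH]; first by rewrite big_ord0 ltxx.
  rewrite !big_ord_recr/=; set s := \sum_(i < n) a`_i in IH *.
  have s0 : 0 <= s by exact: sumr_ge0.
  have [s_eq0|s_neq0] := eqVneq s 0.
    have -> : \sum_(i < n) a`_i *: z i = 0.
      rewrite big1// => i _.
      by rewrite (psumr_eq0P _ s_eq0) ?scale0r// => j _; exact: a0.
    by rewrite s_eq0 !add0r => an; rewrite scalerA mulVf ?gt_eqF// scale1r.
  have sp : 0 < s by rewrite lt_neqAle eq_sym s_neq0.
  move=> tot; set S := s + a`_n in tot *.
  have S0 : S != 0 by rewrite gt_eqF.
  have -> : S^-1 *: (\sum_(i < n) a`_i *: z i + a`_n *: z n) =
      (s / S) *: (s^-1 *: \sum_(i < n) a`_i *: z i) + (1 - s / S) *: z n.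
    rewrite scalerDr !scalerA mulrAC mulfV// mul1r; congr (_ + _ *: _).
    by rewrite -[1](mulfV S0) -mulrBl /S addrAC subrr add0r mulrC.
  apply: Aconv => //; first exact: IH.
  by rewrite divr_ge0 ?(ltW tot)//= ler_pdivrMr// mul1r lerDl.
have sum1 : \sum_(i < size a) a`_i = 1.
  by rewrite -[RHS]a1 tailE; apply: eq_bigr => i _; rewrite leq0n mulr1.
by have := H (size a); rewrite sum1 invr1 scale1r; apply.
Qed.

Lemma norm_comb (R : realType) (X : normedModType R) (z : nat -> X) (a : {poly R}) :
  `|comb z a| <= \sum_(i < size a) `|a`_i| * `|z i|.
Proof.
by apply: le_trans (ler_norm_sum _ _ _) _; apply: ler_sum => i _; rewrite normrZ.
Qed.

Lemma dual_ball_poly (R : realType) (X : normedModType R) c (phi : X -> R)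
    (z : nat -> X) (a : {poly R}) : dual_ball c phi ->
  phi (comb z a) = \sum_(i < size a) a`_i * phi (z i).
Proof.
move=> phic; rewrite (dual_ball_sum phic); apply: eq_bigr => i _.
exact: (dual_ballZ phic).
Qed.

Lemma limn_einf_ge (R : realType) (u : nat -> \bar R) (r : \bar R) :
  (\forall n \near \oo, (r <= u n)%E) -> (r <= limn_einf u)%E.
Proof.
move=> ru; rewrite limn_einf_lim; apply: lime_ge; first exact: is_cvg_einfs.
near=> m; apply: le_ereal_inf_tmp => _ [k /= mk <-].
move: k mk; near: m; case: ru => N _ Nr; exists N => // n /= Nn k nk.
by apply: Nr; exact: leq_trans nk.
Unshelve. all: by end_near. Qed.

Lemma cvg_of_harmonic_bound (R : realType) (X : completeNormedModType R)
    (y : nat -> X) (c : R) : 0 < c ->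
  (forall n m, `|y n - y m| <= c * (n.+1%:R^-1 + m.+1%:R^-1)) -> cvgn y.
Proof.
move=> c0 ylip; apply: cauchy_cvg; apply: cauchy_exP => e e0.
pose N := Num.truncn (2 * c / e); exists (y N); exists N => // n /= Nn.
rewrite -ball_normE/=; apply: le_lt_trans (ylip _ _) _.
apply: (@le_lt_trans _ _ (2 * c / N.+1%:R)); last first.
  rewrite ltr_pdivrMr// [ltRHS]mulrC -ltr_pdivrMr//; exact: truncnS_gt.
have : n.+1%:R^-1 <= N.+1%:R^-1 :> R by rewrite lef_pV2 ?posrE// ler_nat.
move: (N.+1%:R^-1) (n.+1%:R^-1) => u v vu; nra.
Qed.

Section shift.
Variables (R : realType) (X : completeNormedModType R) (z : nat -> X) (c d : R).
Hypotheses (c0 : 0 < c) (d0 : 0 < d).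
Hypothesis shift_le : forall p a, `|comb z ('X^p * a)| <= c * `|comb z a|.
Hypothesis shift_ge : forall p a, `|comb z a| <= c * `|comb z ('X^p * a)|.
Hypothesis tail_le : forall k a, d * `|tail k a| <= `|comb z a|.

Let K := closure [set comb z a | a in @convex_poly R].

Let K_approx x e : K x -> 0 < e -> exists2 a, convex_poly a & `|x - comb z a| < e.
Proof.
move=> Kx e0; have [_ [[a a1 <-] xa]] := Kx _ (nbhsx_ballx x _ e0).
by exists a => //; move: xa; rewrite -ball_normE.
Qed.

Let K_intro x : (forall e, 0 < e -> exists2 a, convex_poly a & `|x - comb z a| < e) ->
  K x.
Proof.
move=> xa B /nbhs_ballP[e /= e0 eB]; have [a a1 ae] := xa _ e0.
exists (comb z a); split; first by exists a.
by apply: eB; rewrite -ball_normE.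
Qed.

Let K_conv : convex_comb_closed K.
Proof.
move=> x y t Kx Ky t01; apply: K_intro => e e0.
have e20 : 0 < e / 2 by rewrite divr_gt0.
have [a a1 xa] := K_approx Kx e20; have [b b1 yb] := K_approx Ky e20.
exists (t *: a + (1 - t) *: b); first exact: convex_poly_conv.
rewrite combD !combZ opprD addrACA -!scalerBr.
apply: le_lt_trans (ler_normD _ _) _; rewrite !normrZ.
have /andP[t0 t1] := t01; rewrite !ger0_norm ?subr_ge0//.
have := ler_wpM2l t0 (ltW xa).
have : (1 - t) * `|y - comb z b| <= (1 - t) * (e / 2).
  by rewrite ler_wpM2l ?subr_ge0// ltW.
lra.
Qed.

(** The shift is [c]-Lipschitz on combinations, so its values along
    combinations converging to [x] converge, and the limit inherits the
    estimate. *)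
Lemma shift_extension : exists f : X -> X, forall x a, K x ->
  `|f x - comb z ('X * a)| <= c * `|x - comb z a|.
Proof.
have /choice[A AP] : forall x, exists A : nat -> {poly R}, K x ->
    forall n, `|x - comb z (A n)| < n.+1%:R^-1.
  move=> x; have [Kx|nKx] := pselect (K x); last by exists (fun=> 0).
  have /choice[A AP] : forall n : nat, exists a, `|x - comb z a| < n.+1%:R^-1.
    by move=> n; have [|a _ xa] := K_approx Kx (e := n.+1%:R^-1); last by exists a.
  by exists A.
exists (fun x => lim (comb z ('X * A x n) @[n --> \oo])) => x a Kx.
have {}AP := AP x Kx; set y := fun n => comb z ('X * A x n).
have yle n b : `|y n - comb z ('X * b)| <= c * (n.+1%:R^-1 + `|x - comb z b|).
  rewrite -combB -mulrBr -['X]expr1; apply: le_trans (shift_le _ _) _.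
  rewrite ler_pM2l// combB -[X in X - _](subrK x) -addrA.
  apply: le_trans (ler_normD _ _) _; apply: lerD => //.
  by rewrite distrC ltW.
have ycvg : cvgn y.
  apply: (cvg_of_harmonic_bound c0) => n m.
  apply: le_trans (yle n (A x m)) _; rewrite ler_pM2l// lerD2l; exact: ltW.
have Hlim : `|y n - comb z ('X * a)| @[n --> \oo] --> `|lim (y @ \oo) - comb z ('X * a)|.
  by apply: cvg_norm; apply: cvgB => //; exact: cvg_cst.
have Hup : c * (n.+1%:R^-1 + `|x - comb z a|) @[n --> \oo] --> c * `|x - comb z a|.
  rewrite -[X in _ --> c * X]add0r; apply: cvgMr.
  by apply: cvgD; [exact: cvg_harmonic|exact: cvg_cst].
apply: ler_cvg_to Hlim Hup _.
by near=> n; exact: yle.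
Unshelve. all: by end_near. Qed.

(** On the closed convex hull of [z] the shift [f] is affine, and its iterates
    satisfy uniform two-sided Lipschitz bounds because the shift by [p] does so
    on combinations, with a constant that does not depend on [p]. If [x] and
    [y] are close to convex combinations with coefficients [a] and [b], then for
    large [n] the difference [x - f^n y] is close to the combination with
    coefficients [a - 'X^n * b], whose tail from [n] on is [-1]; so its norm
    stays above [d / 2]. Hence [theta] is positive and [f] has no fixed
    point. *)
Lemma shift_not_generic_FPP (C : set X) : bounded_closed_convex [set: X] C ->
  (forall i, C (z i)) ->
  ~ generic_FPP C (fun K f =>
    [/\ uniformly_biLipschitz K f, affine_on K f & (0 < theta K f)%E]).
Proof.
move=> [_ _ Cbd Ccl Cconv] Cz CFPP; have [f f1] := shift_extension.
have ce e : 0 < e -> 0 < e / c by move=> e0; rewrite divr_gt0.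
have KC : K `<=` C.
  rewrite [C](closure_id _).1//; apply: closureS => _ [a a1 <-].
  by apply: convex_comb_in => //; exact: convex_setP.
have fK : set_fun K K f.
  move=> x Kx; apply: K_intro => e e0.
  have [a a1 xa] := K_approx Kx (ce _ e0); exists ('X * a).
    by have := convex_poly_shift 1 a1; rewrite expr1.
  by apply: le_lt_trans (f1 x a Kx) _; rewrite mulrC -ltr_pdivlMr.
have fpK p x : K x -> K (iter p f x) by move=> Kx; elim: p => //= p; exact: fK.
have fp_crude p x a : K x ->
    `|iter p f x - comb z ('X^p * a)| <= c ^+ p * `|x - comb z a|.
  move=> Kx; elim: p => [|p IH]; first by rewrite !expr0 !mul1r.
  rewrite iterS exprS -mulrA; apply: le_trans (f1 _ _ (fpK p x Kx)) _.
  by rewrite exprS -mulrA ler_pM2l.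
(* The constant [c ^ p] is improved to [c] by comparison with a combination
   much closer to [x]. *)
have fp p x a : K x -> `|iter p f x - comb z ('X^p * a)| <= c * `|x - comb z a|.
  move=> Kx; apply/ler_addgt0Pr => e e0.
  have k0 : 0 < c ^+ p + c by rewrite addr_gt0// exprn_gt0.
  have [b b1 xb] := K_approx Kx (divr_gt0 e0 k0).
  move: xb; rewrite ltr_pdivlMr// => xb.
  have := fp_crude p x b Kx.
  have := shift_le p (b - a); rewrite mulrBr !combB => ba.
  have ab : `|comb z b - comb z a| <= `|x - comb z b| + `|x - comb z a|.
    by rewrite (distrC x (comb z b)) -[X in `|X| <= _](subrKA x) ler_normD.
  have := ler_normD (iter p f x - comb z ('X^p * b))
    (comb z ('X^p * b) - comb z ('X^p * a)); rewrite subrKA.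
  have : c * `|comb z b - comb z a| <= c * (`|x - comb z b| + `|x - comb z a|).
    by rewrite ler_pM2l.
  lra.
have faff : affine_on K f.
  move=> x y t Kx Ky t01; apply/eqP; rewrite -subr_eq0 -normr_le0.
  apply/ler_addgt0Pr => e e0; rewrite add0r.
  have e'0 : 0 < e / (2 * c) by rewrite divr_gt0// mulr_gt0.
  have [a a1] := K_approx Kx e'0; have [b b1] := K_approx Ky e'0.
  rewrite !ltr_pdivlMr ?mulr_gt0// => yb xa.
  have h := f1 _ (t *: a + (1 - t) *: b) (K_conv Kx Ky t01).
  have hx := f1 x a Kx; have hy := f1 y b Ky.
  have /andP[t0 t1] := t01.
  have Ht u v : `|t *: u + (1 - t) *: v| <= t * `|u| + (1 - t) * `|v|.
    by apply: le_trans (ler_normD _ _) _; rewrite !normrZ !ger0_norm ?subr_ge0.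
  have h1 : `|t *: x + (1 - t) *: y - comb z (t *: a + (1 - t) *: b)| <=
      t * `|x - comb z a| + (1 - t) * `|y - comb z b|.
    by rewrite combD !combZ opprD addrACA -!scalerBr.
  have h2 : `|t *: f x + (1 - t) *: f y - comb z ('X * (t *: a + (1 - t) *: b))| <=
      t * `|f x - comb z ('X * a)| + (1 - t) * `|f y - comb z ('X * b)|.
    by rewrite mulrDr -!scalerAr combD !combZ opprD addrACA -!scalerBr.
  set w := comb z ('X * _) in h h2.
  rewrite -(subrKA w); apply: le_trans (ler_normD _ _) _.
  rewrite [X in _ + X]distrC.
  have : t * `|f x - comb z ('X * a)| <= t * (c * `|x - comb z a|) by rewrite ler_wpM2l.
  have : (1 - t) * `|f y - comb z ('X * b)| <= (1 - t) * (c * `|y - comb z b|).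
    by rewrite ler_wpM2l ?subr_ge0.
  have : c * `|t *: x + (1 - t) *: y - comb z (t *: a + (1 - t) *: b)| <=
      c * (t * `|x - comb z a| + (1 - t) * `|y - comb z b|) by rewrite ler_pM2l.
  have : t * (`|x - comb z a| * (2 * c)) <= t * e by rewrite ler_wpM2l// ltW.
  have : (1 - t) * (`|y - comb z b| * (2 * c)) <= (1 - t) * e.
    by rewrite ler_wpM2l ?subr_ge0// ltW.
  lra.
have fbi : uniformly_biLipschitz K f.
  exists c^-1, c; rewrite invr_gt0; split=> // x y p Kx Ky _.
  rewrite ler_pdivrMl//; apply/andP; split; apply/ler_addgt0Pr => e e0.
    have k0 : 0 < 2 * (1 + c * c) by rewrite mulr_gt0// addr_gt0// mulr_gt0.
    have [a a1 xa] := K_approx Kx (divr_gt0 e0 k0).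
    have [b b1 yb] := K_approx Ky (divr_gt0 e0 k0).
    move: xa yb; rewrite !ltr_pdivlMr// => xa yb.
    have fa := fp p x a Kx; have fb := fp p y b Ky.
    have := shift_ge p (a - b); rewrite mulrBr !combB.
    have := ler_distD (comb z a) x y.
    have := ler_distD (comb z b) (comb z a) y.
    have := ler_distD (iter p f x) (comb z ('X^p * a)) (comb z ('X^p * b)).
    have := ler_distD (iter p f y) (iter p f x) (comb z ('X^p * b)).
    rewrite (distrC (comb z b) y) (distrC (comb z ('X^p * a)) (iter p f x)).
    move=> D1 D2; have D3 := le_trans D2 (lerD fa D1).
    have := ler_wpM2l (ltW c0) fb; have := ler_wpM2l (ltW c0) D3; lra.
  have k0 : 0 < 4 * c by rewrite mulr_gt0.
  have [a a1 xa] := K_approx Kx (divr_gt0 e0 k0).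
  have [b b1 yb] := K_approx Ky (divr_gt0 e0 k0).
  move: xa yb; rewrite !ltr_pdivlMr// => xa yb.
  have fa := fp p x a Kx; have fb := fp p y b Ky.
  have := shift_le p (a - b); rewrite mulrBr !combB.
  have := ler_distD x (comb z a) (comb z b).
  have := ler_distD y x (comb z b).
  have := ler_distD (comb z ('X^p * a)) (iter p f x) (iter p f y).
  have := ler_distD (comb z ('X^p * b)) (comb z ('X^p * a)) (iter p f y).
  rewrite (distrC (comb z a) x) (distrC (comb z ('X^p * b)) (iter p f y)).
  move=> D1 D2 D3 D4; have D5 := le_trans D4 (lerD (lexx _) D3).
  have := ler_wpM2l (ltW c0) D5; lra.
have far x y : K x -> K y -> \forall n \near \oo, d / 2 <= `|x - iter n f y|.
  move=> Kx Ky; have k0 : 0 < 2 * (1 + c) by rewrite mulr_gt0// addr_gt0.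
  pose e : R := d / (2 * (1 + c)); have e0 : 0 < e := divr_gt0 d0 k0.
  have eE : e * (2 * (1 + c)) = d := divfK (lt0r_neq0 k0) d.
  have [a a1 xa] := K_approx Kx e0; have [b b1 yb] := K_approx Ky e0.
  have cyb := ler_wpM2l (ltW c0) (ltW yb).
  exists (size a) => // n /= an; have := fp n y b Ky.
  have := tail_le n (a - 'X^n * b).
  rewrite tailB tail_mulXn subnn b1.2 (tail_oversize an) sub0r normrN1 mulr1 combB.
  have := ler_distD x (comb z a) (comb z ('X^n * b)).
  have := ler_distD (iter n f y) x (comb z ('X^n * b)).
  rewrite (distrC (comb z a) x); lra.
have K1 : K (comb z 1).
  by apply: subset_closure; exists 1 => //; exact: convex_poly1.
have [x Kx fx] : exists2 x, K x & f x = x.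
  apply: (CFPP K) => //.
    split=> //; first by exists (comb z 1).
    - by have [M [Mr CM]] := Cbd; exists M; split=> // N MN x /KC; exact: CM.
    - exact: closed_closure.
    - exact: convex_comb_closedP.
  split=> //; apply: (@lt_le_trans _ _ (d / 2)%:E); first by rewrite lte_fin divr_gt0.
  apply: le_ereal_inf_tmp => _ [[x y] [/= Kx Ky] <-]; apply: limn_einf_ge.
  by have [N _ NP] := far x y Kx Ky; exists N => // n /NP/=; rewrite lee_fin.
have [N _ /(_ N (leqnn N))/=] := far x x Kx Kx.
have -> : iter N f x = x by elim: N => //= N ->.
by rewrite subrr normr0 leNgt divr_gt0.
Qed.

End shift.

(** * Rosenthal's l1 theorem *)

Section infinite_subsets.
Implicit Types (L M : set nat).

(** Infinite sets of indices, in a form that yields elements beyond any given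
    bound. *)
Definition unbounded L := forall n, exists2 m, (n <= m)%N & L m.

Lemma unboundedT : unbounded setT.
Proof. by move=> n; exists n. Qed.

Lemma not_unbounded L : ~ unbounded L -> exists N, forall m, (N <= m)%N -> ~ L m.
Proof.
move=> /existsNP[N NL]; exists N => m Nm Lm; apply: NL; by exists m.
Qed.

Lemma unbounded_almost_subset L M N : unbounded L ->
  (forall m, (N <= m)%N -> L m -> M m) -> unbounded M.
Proof.
move=> Linf LM n; have [m + Lm] := Linf (maxn n N).
by rewrite geq_max => /andP[nm Nm]; exists m => //; exact: LM.
Qed.

Lemma pigeonhole (J : finType) (c : nat -> J) L : unbounded L ->
  exists t, unbounded [set j | L j /\ c j = t].
Proof.
move=> Linf; apply: contrapT => /forallNP nL.
have /choice[N NP] t : exists N, forall m, (N <= m)%N -> ~ (L m /\ c m = t).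
  exact/not_unbounded/nL.
have [m Nm Lm] := Linf (\max_t N t); apply: (NP (c m) m) => //.
exact: leq_trans (leq_bigmax _) Nm.
Qed.

Lemma unbounded_enum L : unbounded L ->
  exists2 g : nat -> nat, {homo g : m n / (m < n)%N} & forall n, L (g n).
Proof.
move=> Linf.
have [l _|g gP] := @history_choice nat 0%N (fun l j => (last 0 l < j)%N /\ L j).
  by have [m lm Lm] := Linf (last 0%N l).+1; exists m.
exists g => [|n]; last by have [] := gP n.
apply: homo_ltn => [? ? ?|n]; first exact: ltn_trans.
by have [] := gP n.+1; rewrite mkseqS last_rcons.
Qed.

Lemma increasing_ge_id (g : nat -> nat) : {homo g : m n / (m < n)%N} ->
  forall n, (n <= g n)%N.
Proof.
by move=> ginc; elim=> // n IH; exact: leq_ltn_trans IH (ginc _ _ (ltnSn n)).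
Qed.

(** The elements of the diagonal set come from a decreasing sequence of sets
    satisfying the successive properties, so from some point on they all lie in
    the [k]-th one. *)
Lemma diagonal_subset (P : nat -> set nat -> Prop) M :
  (forall k L L' N, P k L -> (forall m, (N <= m)%N -> L' m -> L m) -> P k L') ->
  (forall k L, unbounded L -> L `<=` M ->
    exists L', [/\ unbounded L', L' `<=` L & P k L']) ->
  unbounded M -> exists L, [/\ unbounded L, L `<=` M & forall k, P k L].
Proof.
move=> Pher Pden Minf; pose prev (l : seq (set nat * nat)) := (last (M, 0%N) l).1.
pose Q l (t : set nat * nat) := [/\ unbounded t.1, t.1 `<=` prev l, prev l `<=` M,
  P (size l) t.1 & t.1 t.2 /\ (size l <= t.2)%N].
have [l lQ|u uQ] := @history_choice _ (M, 0%N) Q.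
  have [linf lM] : unbounded (prev l) /\ prev l `<=` M.
    case/lastP: l lQ => [|l t] lQ; first by split.
    have := lQ (size l); rewrite size_rcons ltnSn nth_rcons ltnn eqxx.
    rewrite -cats1 take_size_cat// => /(_ isT)[tinf tl lM _ _].
    by rewrite /prev cats1 last_rcons; split=> // n /tl/lM.
  have [L [Linf Ll PL]] := Pden (size l) _ linf lM.
  have [m lm Lm] := Linf (size l).
  by exists (L, m); split.
have Lsub i j : (i <= j)%N -> (u j).1 `<=` (u i).1.
  move=> /subnK <-; elim: (j - i)%N => // n IH; rewrite addSn.
  have [_ + _ _ _] := uQ (n + i).+1; rewrite /prev mkseqS last_rcons.
  by move=> h; exact: subset_trans h IH.
have uM i : (u i).1 `<=` M.
  by have [_ h1 h2 _ _] := uQ i; exact: subset_trans h1 h2.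
have uu i : (u i).1 (u i).2 /\ (i <= (u i).2)%N.
  by have [_ _ _ _] := uQ i; rewrite size_mkseq.
exists (range (fun i => (u i).2)); split.
- by move=> n; exists (u n).2; [exact: (uu n).2|exists n].
- by move=> _ [i _ <-]; apply: uM; exact: (uu i).1.
- move=> k; have [_ _ _ + _] := uQ k; rewrite size_mkseq.
  move/(@Pher _ _ _ (\max_(i < k) (u i).2).+1).
  apply=> m /[swap] -[i _ <-]; apply: contraPP => uik.
  have ik : (i < k)%N.
    by rewrite ltnNge; apply/negP => ki; apply: uik; exact: Lsub ki _ (uu i).1.
  apply/negP; rewrite -ltnNge ltnS.
  exact: (@leq_bigmax _ (fun i : 'I_k => (u i).2) (Ordinal ik)).
Qed.

End infinite_subsets.

Section independence.
Variables (T : Type) (A : bool -> nat -> set T).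
Implicit Types (S : set T) (L M : set nat).

(** Used with [A true n] and [A false n] the functionals that are large,
    respectively small, at the [n]-th point of a sequence: [t] oscillates along
    [L] if both cases occur infinitely often. *)
Definition oscillates (t : T) L := forall e, unbounded [set n | L n /\ A e n t].

Definition hereditarily_oscillating S L := forall L', unbounded L' -> L' `<=` L ->
  exists2 t, S t & oscillates t L'.

Lemma oscillates_almost_subset t L L' N :
  (forall m, (N <= m)%N -> L' m -> L m) -> oscillates t L' -> oscillates t L.
Proof.
move=> L'L osc e; apply: (@unbounded_almost_subset _ _ N (osc e)) => m Nm [L'm Am].
by split=> //; exact: L'L.
Qed.

(** Otherwise a diagonal set [L] is such that, for every [j], no point of some
    [S i] in some [A e j] oscillates along [L]. The same pair [(i, e)] occurs
    for all [j] in an infinite subset [L'] of [L]; but a point of [S i]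
    oscillating along [L'] is in [A e j] for some [j] in [L']. *)
Lemma oscillation_split (I : finType) (S : I -> set T) M : unbounded M ->
  (forall i, hereditarily_oscillating (S i) M) ->
  exists j L, unbounded L /\
    forall i e, hereditarily_oscillating (S i `&` A e j) L.
Proof.
move=> Minf Sosc; apply: contrapT => /forallNP nex.
pose P j L := exists ie : I * bool,
  forall t, S ie.1 t -> A ie.2 j t -> ~ oscillates t L.
have [j L L' N [ie ieP] L'L|j L Linf LM||L [Linf LM PL]] := @diagonal_subset P M.
- exists ie => t St At /(oscillates_almost_subset L'L); exact: ieP.
- have /forallNP/(_ L)/not_andP[//|/existsNP[i /existsNP[e]]] := nex j.
  move=> /existsNP[L' /not_implyP[L'inf /not_implyP[L'L nt]]].
  exists L'; split=> //; exists (i, e) => t St At osc; apply: nt.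
  by exists t.
- by [].
have [ie ieP] := choice PL; have [[i e] ieinf] := pigeonhole ie Linf.
have L'L : [set j | L j /\ ie j = (i, e)] `<=` L by move=> j [].
have [t St tosc] := Sosc i _ ieinf (subset_trans L'L LM).
have [j _ [[Lj iej] At]] := tosc e 0%N.
have := ieP j t; rewrite iej => /(_ St At); apply.
by apply: (@oscillates_almost_subset _ _ _ 0%N _ tosc) => m _; exact: L'L.
Qed.

(** Iterating [oscillation_split] on the cells cut out of [S] by the sign
    patterns at the indices chosen so far keeps all cells oscillating, in
    particular nonempty. *)
Lemma independent_subsequence S M : unbounded M -> hereditarily_oscillating S M ->
  exists g : nat -> nat, forall n (eps : nat -> bool),
    exists2 t, S t & forall k, (k < n)%N -> A (eps k) (g k) t.
Proof.
move=> Minf Sosc; pose cell (l : seq (nat * set nat)) (eps : nat -> bool) :=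
  [set t | S t /\ forall i, (i < size l)%N -> A (eps i) (nth (0%N, M) l i).1 t].
pose Q l (p : nat * set nat) := unbounded p.2 /\
  forall eps, hereditarily_oscillating (cell (rcons l p) eps) p.2.
have oscS S' S'' L : S' `<=` S'' -> hereditarily_oscillating S' L ->
    hereditarily_oscillating S'' L.
  by move=> SS osc L' /osc /[apply] -[t /SS]; exists t.
have [l lQ|u uQ] := @history_choice _ (0%N, M) Q.
  have [L [Linf Losc]] : exists L, unbounded L /\
      forall eps, hereditarily_oscillating (cell l eps) L.
    case/lastP: l lQ => [|l p] lQ.
      by exists M; split=> // eps; apply: oscS Sosc => t St; split.
    have := lQ (size l); rewrite size_rcons ltnSn nth_rcons ltnn eqxx.
    rewrite -cats1 take_size_cat// => /(_ isT)[pinf posc].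
    by exists p.2; split=> // eps; rewrite cats1.
  have [j [L' [L'inf L'osc]]] := @oscillation_split
    ((size l).-tuple bool) (fun b => cell l (nth false b)) L Linf (fun b => Losc _).
  exists (j, L'); split=> // eps.
  apply: oscS (L'osc [tuple eps i | i < size l] (eps (size l))).
  move=> t [[St At] Aj]; split=> // i; rewrite size_rcons ltnS leq_eqVlt.
  rewrite nth_rcons; case: ltngtP => //= [il _|-> _]//.
  by have := At i il; rewrite -(nth_mktuple (fun i => eps i) false (Ordinal il)).
exists (fun k => (u k).1) => n eps; have [uinf uosc] := uQ n.
have [t [St At] _] := uosc eps _ uinf (@subset_refl _ _).
exists t => // k kn; have := At k; rewrite -mkseqS size_mkseq nth_mkseq; last exact: ltnW.
by apply; exact: ltnW.
Qed.

End independence.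

(** The limit is the supremum of the numbers exceeded infinitely often. *)
Lemma cvg_no_oscillation (R : realType) (u : nat -> R) (B : R) :
  (forall n, `|u n| <= B) ->
  (forall r s : rat, r < s ->
    ~ (unbounded [set n | u n < ratr r] /\ unbounded [set n | ratr s < u n])) ->
  cvgn u.
Proof.
move=> uB nosc; pose S := [set q | unbounded [set n | q < u n]].
have uBB n : - B <= u n <= B by rewrite -ler_norml.
have S0 : S !=set0.
  exists (- B - 1) => n; exists n => //=; have /andP[+ _] := uBB n; lra.
have Sub : ubound S B.
  by move=> q /(_ 0%N)[n _ /= qn]; have /andP[_] := uBB n; lra.
have Sup : has_sup S by split=> //; exists B.
apply/cvg_ex; exists (sup S); apply/cvgrPdist_le => e e0.
have [N NP] : exists N, forall m, (N <= m)%N -> ~ (sup S + e < u m).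
  apply: not_unbounded => h; have := ub_le_sup Sup.2 h; lra.
have [q Sq qS] := sup_adherent e0 Sup.
have [s /[!in_itv]/= /andP[s1 s2]] := rat_in_itvoo qS.
have [r /[!in_itv]/= /andP[r1 r2]] := rat_in_itvoo s1.
have rs : r < s by rewrite -(ltr_rat R).
have [N' N'P] : exists N, forall m, (N <= m)%N -> ~ (u m < ratr r).
  apply: not_unbounded => h; apply: (nosc r s rs); split=> //.
  by apply: (@unbounded_almost_subset _ _ 0%N Sq) => m _ /=; exact: lt_trans.
exists (maxn N N') => // n /=; rewrite geq_max => /andP[/NP + /N'P].
move=> /negP; rewrite -leNgt => h1 /negP; rewrite -leNgt => h2.
rewrite ler_norml; lra.
Qed.

(** Either every pair of rationals [r < s] can be dealt with by passing to a
    subsequence, and a diagonal subsequence is weak Cauchy; or, for some pair,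
    there are indices such that all sign patterns [phi x_i > s] or
    [phi x_i < r] are realized by functionals in the dual unit ball. In that
    case two functionals with opposite patterns, following the signs of the
    coefficients, differ by at least [(s - r) * \sum_i |a_i|] at the
    combination. *)
Lemma rosenthal_l1 (R : realType) (X : normedModType R) (x : nat -> X) (B : R) :
  (forall n, `|x n| <= B) ->
  (exists2 g : nat -> nat, {homo g : m n / (m < n)%N} & weak_cauchy (x \o g)) \/
  (exists (g : nat -> nat) (c : R), 0 < c /\ forall a : {poly R},
    c * (\sum_(i < size a) `|a`_i|) <= `|comb (x \o g) a|).
Proof.
move=> xB.
pose A (rs : rat * rat) (e : bool) n : set (X -> R) :=
  [set phi | if e then ratr rs.2 < phi (x n) else phi (x n) < ratr rs.1].
have [[rs [M [rs12 Minf osc]]]|nosc] := pselect (exists (rs : rat * rat) M,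
    [/\ rs.1 < rs.2, unbounded M & hereditarily_oscillating (A rs) (@dual_ball R X 1) M]).
  right; have [g gP] := independent_subsequence Minf osc.
  have srp : 0 < ratr rs.2 - ratr rs.1 :> R by rewrite subr_gt0 ltr_rat.
  exists g, ((ratr rs.2 - ratr rs.1) / 2); split=> [|a]; first by rewrite divr_gt0.
  have [phi phi1 phiA] := gP (size a) (fun i => 0 <= a`_i).
  have [psi psi1 psiA] := gP (size a) (fun i => ~~ (0 <= a`_i)).
  have sumle : (ratr rs.2 - ratr rs.1) * (\sum_(i < size a) `|a`_i|) <=
      phi (comb (x \o g) a) - psi (comb (x \o g) a).
    rewrite (dual_ball_poly _ _ phi1) (dual_ball_poly _ _ psi1) -sumrB mulr_sumr.
    apply: ler_sum => i _; rewrite -mulrBr.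
    have := phiA i (ltn_ord i); have := psiA i (ltn_ord i); rewrite /A /=.
    have [a0|a0] /= := leP 0 a`_i => h1 h2.
      rewrite (ger0_norm a0) mulrC; apply: ler_wpM2l => //; lra.
    rewrite (ltr0_norm a0) -[leRHS]mulrNN mulrC.
    by apply: ler_wpM2l; [rewrite oppr_ge0 ltW|lra].
  have := phi1.2 (comb (x \o g) a); have := psi1.2 (comb (x \o g) a).
  rewrite !mul1r !ler_norml; lra.
left; pose P k (L : set nat) :=
  if unpickle k : option (rat * rat) is Some rs then rs.1 < rs.2 ->
  forall phi, @dual_ball R X 1 phi -> ~ oscillates (A rs) phi L else True.
have [k L L' N|k L Linf _||L [Linf _ LP]] := @diagonal_subset P setT.
- rewrite /P; case: unpickle => // rs LP L'L /LP + phi phi1.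
  move=> /(_ _ phi1) nL /(oscillates_almost_subset L'L); exact: nL.
- rewrite /P; case: unpickle => [rs|]; last by exists L; split.
  have [rs12|/negP rs12] := boolP (rs.1 < rs.2); last by exists L; split.
  have /existsNP[L' /not_implyP[L'inf /not_implyP[L'L nt]]] :
      ~ hereditarily_oscillating (A rs) (@dual_ball R X 1) L.
    by move=> h; apply: nosc; exists rs, L.
  by exists L'; split=> // _ phi phi1 osc; apply: nt; exists phi.
- exact: unboundedT.
have [g ginc gL] := unbounded_enum Linf.
have gid := increasing_ge_id ginc.
exists g => // f; have [c c0 fc] := ball_of_dual f.
have fE n : c * (c^-1 * f (x (g n))) = f (x (g n)).
  by rewrite mulrA mulfV ?gt_eqF// mul1r.
have phi1 : dual_ball 1 (fun y => c^-1 * f y).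
  split=> [a y z|y]; first by rewrite fc.1; ring.
  by rewrite normrM gtr0_norm ?invr_gt0// mul1r ler_pdivrMl//; exact: fc.2.
suff /cvg_ex[l ul] : cvgn (fun n => c^-1 * f (x (g n))).
  by apply/cvg_ex; exists (c * l); under eq_fun do rewrite /= -fE; exact: cvgMr.
apply: (@cvg_no_oscillation _ _ B) => [n|r s rs [hr hs]].
  by apply: le_trans (phi1.2 _) _; rewrite mul1r.
have := LP (pickle (r, s)); rewrite /P pickleK => /(_ rs _ phi1); apply => e.
move=> n; have [m nm um] : exists2 m, (n <= m)%N & A (r, s) e (g m) (fun y => c^-1 * f y).
  by case: e; [exact: hs|exact: hr].
by exists (g m); [exact: leq_trans nm (gid m)|split].
Qed.

(** * Uniform boundedness on the dual space *)

(** Completeness of the dual space, for sequences with an explicit Cauchy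
    modulus. *)
Lemma dual_limit (R : realType) (X : normedModType R) (psi : nat -> X -> R)
    (r : nat -> R) : (forall k, exists c, dual_ball c (psi k)) ->
  (forall k, r k <= k.+1%:R^-1) ->
  (forall k m x, (k <= m)%N -> `|psi m x - psi k x| <= r k * `|x|) ->
  exists chi, forall k, dual_ball (r k) (fun x => chi x - psi k x).
Proof.
move=> psiL rh psir.
have psicvg x : cvgn (fun k => psi k x : R^o).
  have x1 : 0 < `|x| + 1 by rewrite ltr_wpDl.
  have h0 (i : nat) : 0 < i.+1%:R^-1 :> R by rewrite invr_gt0.
  have H i j : (i <= j)%N -> `|psi j x - psi i x| <= (`|x| + 1) * i.+1%:R^-1.
    move=> ij; apply: le_trans (psir _ _ x ij) _.
    apply: le_trans (ler_wpM2r (normr_ge0 x) (rh i)) _.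
    by rewrite mulrC ler_wpM2r ?lerDl// ltW.
  apply: (cvg_of_harmonic_bound x1) => n m; rewrite mulrDr.
  have [nm|/ltnW mn] := leqP n m.
    by rewrite distrC; apply: le_trans (H _ _ nm) _; rewrite lerDl mulr_ge0// ltW.
  by apply: le_trans (H _ _ mn) _; rewrite lerDr mulr_ge0// ltW.
exists (fun x => lim ((psi k x : R^o) @[k --> \oo])) => k.
have chiL a x y : lim ((psi k (a *: x + y) : R^o) @[k --> \oo]) =
    a * lim ((psi k x : R^o) @[k --> \oo]) + lim ((psi k y : R^o) @[k --> \oo]).
  apply: cvg_lim => //; have psiE n : psi n (a *: x + y) = a * psi n x + psi n y.
    by have [c psic] := psiL n; exact: psic.1.
  under eq_fun do rewrite psiE.
  apply: (@cvgD _ R^o); last exact: psicvg.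
  by apply: cvgMr; exact: psicvg.
split=> [a x y|x].
  by have [c psic] := psiL k; rewrite chiL psic.1; ring.
have H : `|(psi m x : R^o) - psi k x| @[m --> \oo] -->
    `|lim ((psi k x : R^o) @[k --> \oo]) - psi k x|.
  by apply: cvg_norm; apply: cvgB; [exact: psicvg|exact: cvg_cst].
rewrite -(cvg_lim _ H)//; apply: limr_le; first by apply/cvg_ex; eexists; exact: H.
by exists k => // m /= km; exact: psir.
Qed.

Section uniform_boundedness.
Variables (R : realType) (X : normedModType R) (y : nat -> X).

Let p n (phi : X -> R) := \sum_(i < n) `|phi (y i)|.

Hypothesis p_bounded : forall phi, dual_ball 1 phi -> exists K, forall n, p n phi <= K.

Let p_boundedc c phi : dual_ball c phi -> exists K, forall n, p n phi <= K.
Proof.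
move=> phic; pose c' := `|c| + 1.
have c'0 : 0 < c' by rewrite ltr_wpDl.
have cc' : c <= c' by rewrite (le_trans (ler_norm c))// lerDl.
have [|K KP] := @p_bounded (fun x => c'^-1 * phi x).
  split=> [a x z|x]; first by rewrite phic.1; ring.
  rewrite normrM gtr0_norm ?invr_gt0// mul1r ler_pdivrMl//.
  exact: (dual_ballW cc' phic).2.
exists (c' * K) => n; rewrite -ler_pdivrMl//; apply: le_trans (KP n).
rewrite /p mulr_sumr; apply: ler_sum => i _.
by rewrite normrM gtr0_norm ?invr_gt0.
Qed.

(** If the bounds are not uniform, every ball of functionals contains a smaller
    ball on which some partial sum exceeds any given number; the functional
    common to a suitable nested sequence of balls has unbounded partial sums. *)
Lemma uniform_boundedness :
  exists2 K, 0 <= K & forall n phi, dual_ball 1 phi -> p n phi <= K.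
Proof.
apply: contrapT => nK.
have {}nK K : exists n phi, dual_ball 1 phi /\ K < p n phi.
  apply: contrapT => /forallNP h; apply: nK; exists `|K| => // n phi phi1.
  rewrite leNgt; apply/negP => Kp; apply: (h n); exists phi; split=> //.
  exact: le_lt_trans (ler_norm K) Kp.
pose prev (l : seq ((X -> R) * R)) := last (fun=> 0, 1) l.
pose Q l (t : (X -> R) * R) := [/\ 0 < t.2 /\ exists c, dual_ball c t.1,
  t.2 <= (prev l).2 / 2, t.2 <= (size l).+1%:R^-1,
  dual_ball ((prev l).2 / 2) (fun x => t.1 x - (prev l).1 x) &
  exists n, forall chi, dual_ball t.2 (fun x => chi x - t.1 x) ->
    (size l)%:R < p n chi].
have [l lQ|u uQ] := @history_choice _ (fun=> 0, 1) Q.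
  have [r0 [c phic]] : 0 < (prev l).2 /\ exists c, dual_ball c (prev l).1.
    case/lastP: l lQ => [|l t] lQ.
      split; first exact: ltr01.
      by exists 0; split=> [a x z|x]; rewrite ?normr0 ?mul0r// mulr0 addr0.
    have := lQ (size l); rewrite size_rcons ltnSn nth_rcons ltnn eqxx.
    by rewrite /prev last_rcons => /(_ isT)[].
  move: r0 phic; rewrite /Q; move: (prev l) => [phi r]/= r0 phic.
  have [K0 K0P] := p_boundedc phic.
  have r20 : 0 < r / 2 by rewrite divr_gt0.
  have [n [th [th1 thn]]] := nK (((size l)%:R + 1 + K0) / (r / 2)).
  rewrite ltr_pdivrMr// in thn.
  pose psi x := phi x + r / 2 * th x.
  have psin : (size l)%:R + 1 < p n psi.
    have : p n th * (r / 2) <= p n psi + p n phi.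
      rewrite /p mulr_suml -big_split/=; apply: ler_sum => i _.
      rewrite mulrC -[r / 2 in leLHS]gtr0_norm// -normrM.
      have := ler_normB (psi (y i)) (phi (y i)).
      by rewrite {1}/psi addrAC subrr add0r.
    by have := K0P n; lra.
  pose L := \sum_(i < n) `|y i|.
  have L0 : 0 <= L by exact: sumr_ge0.
  have L1 : 0 < L + 1 by rewrite ltr_wpDl.
  (* Within [r'] of [psi] the [n]-th partial sum changes by at most
     [r' * L <= 1]. *)
  pose r' := Num.min (r / 2) (Num.min (size l).+1%:R^-1 (L + 1)^-1).
  have r'0 : 0 < r' by rewrite !lt_min r20 !invr_gt0 L1 ltr0Sn.
  exists (psi, r'); split=> /=.
  - split=> //; exists (`|1| * c + `|r / 2| * 1).
    have := dual_ball_comb 1 (r / 2) phic th1.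
    by under eq_fun do rewrite mul1r.
  - by rewrite ge_min lexx.
  - by rewrite !ge_min lexx orbT.
  - split=> [a x z|x]; first by rewrite /psi phic.1 th1.1; ring.
    rewrite /psi addrAC subrr add0r normrM (gtr0_norm r20) ler_pM2l//.
    by have := th1.2 x; rewrite mul1r.
  exists n => chi chir.
  have : p n psi <= p n chi + r' * L.
    rewrite /p /L mulr_sumr -big_split/=; apply: ler_sum => i _.
    have := ler_normB (chi (y i)) (chi (y i) - psi (y i)).
    rewrite subKr => /le_trans; apply; rewrite lerD2l; exact: chir.2.
  have : r' * L <= 1.
    apply: (@le_trans _ _ ((L + 1)^-1 * (L + 1))); last by rewrite mulVf ?gt_eqF.
    by apply: ler_pM; rewrite ?(ltW r'0)// ?lerDl// !ge_min lexx !orbT.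
  lra.
have uS k : dual_ball ((u k).2 / 2) (fun x => (u k.+1).1 x - (u k).1 x) /\
    (u k.+1).2 <= (u k).2 / 2.
  by have [_ h _ h' _] := uQ k.+1; move: h h'; rewrite /prev mkseqS last_rcons.
have u0 k : 0 < (u k).2 /\ exists c, dual_ball c (u k).1 by have [] := uQ k.
have uh k : (u k).2 <= k.+1%:R^-1 by have [_ _] := uQ k; rewrite size_mkseq.
have ukm k m x : (k <= m)%N -> `|(u m).1 x - (u k).1 x| <= ((u k).2 - (u m).2) * `|x|.
  move=> /subnK <-; elim: (m - k)%N => [|j IH].
    by rewrite add0n !subrr normr0 mul0r.
  rewrite addSn; have [h1 h2] := uS (j + k)%N.
  have := ler_normD ((u (j + k).+1).1 x - (u (j + k)%N).1 x)
    ((u (j + k)%N).1 x - (u k).1 x).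
  rewrite subrKA => /le_trans; apply.
  apply: le_trans (lerD (h1.2 x) IH) _; rewrite -mulrDl ler_wpM2r//; lra.
have [||chi chiP] := @dual_limit _ _ (fun k => (u k).1) (fun k => (u k).2) _ uh.
- by move=> k; have [] := u0 k.
- move=> k m x km; apply: le_trans (ukm _ _ x km) _; rewrite ler_wpM2r//.
  by rewrite gerBl ltW//; have [] := u0 m.
have [_ [c u0c]] := u0 0%N.
have [K KP] : exists K, forall n, p n chi <= K.
  apply: (@p_boundedc (`|1| * (u 0%N).2 + `|1| * c)).
  have := dual_ball_comb 1 1 (chiP 0%N) u0c.
  by under eq_fun do rewrite !mul1r subrK.
have [_ _ _ _ [n /(_ _ (chiP _))]] := uQ (Num.truncn K).+1.
rewrite size_mkseq => Kn; have := KP n; have := truncnS_gt K; lra.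
Qed.

End uniform_boundedness.

(** * Sequences extracted from a failure of weak compactness *)

Lemma sum_geometric_half (R : realType) n : \sum_(i < n) 2^-1 ^+ i <= 2 :> R.
Proof.
suff -> : \sum_(i < n) 2^-1 ^+ i = 2 - 2 * 2^-1 ^+ n :> R.
  by rewrite gerBl mulr_ge0// exprn_ge0// invr_ge0.
elim: n => [|n IH]; first by rewrite big_ord0 expr0; lra.
by rewrite big_ord_recr/= IH exprS; lra.
Qed.

(** The weak limit of a filter [F] on [X], if it is not required to be a point
    of [X], is a bounded functional [Phi] on the dual space. *)
Section filter_functional.
Variables (R : realType) (X : completeNormedModType R) (F : set_system X).
Variables (C : set X) (Phi : (X -> R) -> R).
Context {FF : ProperFilter F}.
Hypotheses (FC : F C) (Ccl : closed C) (Cconv : convex_comb_closed C).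
Hypothesis PhiP : forall phi, dual_ball 1 phi -> phi x @[x --> F] --> Phi phi.

Lemma Phi_near phi e : dual_ball 1 phi -> 0 < e -> F [set x | `|Phi phi - phi x| <= e].
Proof.
move=> phi1 e0; have /cvgrPdist_le/(_ _ e0) := PhiP phi1; exact.
Qed.

Lemma Phi_conv phi psi t : dual_ball 1 phi -> dual_ball 1 psi -> 0 <= t <= 1 ->
  Phi (fun x => t * phi x + (1 - t) * psi x) = t * Phi phi + (1 - t) * Phi psi.
Proof.
move=> phi1 psi1 t01.
have h1 := PhiP (dual_ball_conv t01 phi1 psi1).
have h2 : t * phi x + (1 - t) * psi x @[x --> F] --> t * Phi phi + (1 - t) * Phi psi.
  by apply: cvgD; apply: cvgMr; exact: PhiP.
by rewrite -(cvg_lim _ h1)//; apply: cvg_lim.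
Qed.

Lemma Phi_opp phi : dual_ball 1 phi -> Phi (fun x => - phi x) = - Phi phi.
Proof.
move=> phi1; have h1 := PhiP (dual_ball_opp phi1).
have h2 : - phi x @[x --> F] --> - Phi phi by apply: cvgN; exact: PhiP.
by rewrite -(cvg_lim _ h1)//; apply: cvg_lim.
Qed.

(** Otherwise [Phi] would be a limit of evaluations at points of [X], hence, [X]
    being complete, the evaluation at some [x]; and [x] is in [C] because [C] is
    weakly closed. *)
Lemma Phi_distance : ~ (exists2 x, C x & F --> (x : weak_topology X)) ->
  exists2 d, 0 < d & forall x, exists2 phi, dual_ball 1 phi & d < Phi phi - phi x.
Proof.
move=> nF; apply: contrapT => nd.
have /choice[x xP] (n : nat) : exists x, forall phi, dual_ball 1 phi ->
    Phi phi - phi x <= n.+1%:R^-1.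
  apply: contrapT => /forallNP h; apply: nd; exists n.+1%:R^-1 => [|x].
    by rewrite invr_gt0.
  have /existsNP[phi /not_implyP[phi1 /negP]] := h x.
  by rewrite -ltNge; exists phi.
have {}xP n phi : dual_ball 1 phi -> `|Phi phi - phi (x n)| <= n.+1%:R^-1.
  move=> phi1; rewrite ler_norml xP// andbT lerNl opprB.
  by have := xP n _ (dual_ball_opp phi1); rewrite Phi_opp// opprK addrC.
have xcvg : cvgn x.
  apply: (cvg_of_harmonic_bound ltr01) => n m; rewrite mul1r.
  apply: norm_le_dual => phi phi1; rewrite (dual_ballB phi1).
  have := xP n _ phi1; have := xP m _ phi1; rewrite !ler_norml.
  move: (n.+1%:R^-1) (m.+1%:R^-1) => u v /andP[? ?] /andP[? ?]; lra.
pose l := lim (x @ \oo).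
have PhiE phi : dual_ball 1 phi -> Phi phi = phi l.
  move=> phi1; apply/eqP; rewrite -subr_eq0 -normr_le0; apply/ler_addgt0Pr => e e0.
  rewrite add0r; have e20 : 0 < e / 2 by rewrite divr_gt0.
  have /cvgrPdist_le/(_ _ e20)[N1 _ N1P] := xcvg.
  pose n := maxn N1 (Num.truncn (e / 2)^-1).
  have nl : `|l - x n| <= e / 2 := N1P n (leq_maxl _ _).
  have ne : n.+1%:R^-1 <= e / 2.
    rewrite invf_ple ?posrE//; apply: le_trans (ltW (truncnS_gt _)) _.
    by rewrite ler_nat ltnS leq_maxr.
  have := xP n _ phi1; have := phi1.2 (l - x n); rewrite mul1r (dual_ballB phi1).
  move=> h1 h2; have h3 := le_trans h2 ne.
  have := ler_normD (Phi phi - phi (x n)) (phi (x n) - phi l).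
  rewrite subrKA (distrC (phi (x n)) (phi l)); lra.
apply: nF; exists l; last by apply: ball_weak_cvg => phi phi1; rewrite -PhiE//; exact: PhiP.
apply: contrapT => nCl; have [c0 Cc0] := filter_ex FC.
have [phi [r [phi1 r0 phir]]] := closed_separation (ex_intro _ c0 Cc0) Ccl Cconv nCl.
have r20 : 0 < r / 2 by rewrite divr_gt0.
have [y [Cy /= yl]] := filter_ex (filterI FC (Phi_near phi1 r20)).
by have := phir _ Cy; move: yl; rewrite PhiE// ler_norml; lra.
Qed.

Variable M : R.
Hypothesis CM : forall x, C x -> `|x| <= M.

Lemma Phi_bound phi : dual_ball 1 phi -> Phi phi <= M + 1.
Proof.
move=> phi1; have [y [Cy /= yl]] := filter_ex (filterI FC (Phi_near phi1 ltr01)).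
have := CM Cy; have := phi1.2 y; move: yl; rewrite mul1r !ler_norml; lra.
Qed.

(** Relative to the functionals in [B], the distance of [Phi] from every point
    of [X] is at least [d]. *)
Definition far_from_points d (B : set (X -> R)) := forall x d', d' < d ->
  exists2 phi, B phi & d' < Phi phi - phi x.

(** A one-dimensional form of Helly's theorem. For real [b], some [phi] in [B]
    has [Phi phi - phi x > d'' + b * phi y]. For very negative [b] this forces
    [phi y > 0], or else [|phi y| <= e] and [phi] is as wanted; for large [b]
    it forces [phi y <= 0] in the same sense. When [b] increases by small
    steps, the sign of [phi y] changes between two consecutive steps, and a
    convex combination of the two functionals vanishes at [y]. *)
Lemma far_from_points_small d (B : set (X -> R)) y e : 0 < e ->
  B `<=` dual_ball 1 ->
  (forall phi psi t, B phi -> B psi -> 0 <= t <= 1 ->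
    B (fun x => t * phi x + (1 - t) * psi x)) ->
  far_from_points d B -> far_from_points d [set phi | B phi /\ `|phi y| <= e].
Proof.
move=> e0 B1 Bconv Bfar x d' d'd; apply: contrapT => nex.
have H phi : B phi -> `|phi y| <= e -> Phi phi - phi x <= d'.
  move=> Bphi phiy; rewrite leNgt; apply/negP => h; apply: nex; exists phi => //.
pose d'' := (d + d') / 2; have d''d : d'' < d by rewrite /d''; lra.
have d'd'' : d' < d'' by rewrite /d''; lra.
pose above b phi := B phi /\ d'' < Phi phi - phi x - b * phi y.
have aboveP b : exists phi, above b phi.
  have [phi Bphi] := Bfar (x + b *: y) _ d''d; rewrite (dual_ballD (B1 _ Bphi)).
  by rewrite (dual_ballZ (B1 _ Bphi)) => h; exists phi; split=> //; lra.
pose W := M + 1 + `|x|.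
have vW phi : B phi -> Phi phi - phi x <= W.
  move=> Bphi; have := Phi_bound (B1 _ Bphi); have := (B1 _ Bphi).2 x.
  by rewrite mul1r ler_norml /W; lra.
pose N := `|W - d''| / e.
have N0 : 0 <= N by rewrite divr_ge0// ltW.
have NE : N * e = `|W - d''| by rewrite divfK// gt_eqF.
have WN u : 0 <= u -> d'' + N * u < W -> u <= e.
  move=> u0 h; rewrite leNgt; apply/negP => eu.
  have : N * e <= N * u by rewrite ler_wpM2l// ltW.
  have := ler_norm (W - d''); lra.
have above_large b phi : N <= b -> above b phi -> phi y <= 0.
  move=> Nb [Bphi bphi]; rewrite leNgt; apply/negP => u0.
  have Nbu : N * phi y <= b * phi y by rewrite ler_pM2r.
  have := H _ Bphi; have := vW _ Bphi => vphi; rewrite gtr0_norm// => h.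
  have ue : phi y <= e by apply: WN; [exact: ltW|lra].
  have := h ue; have := mulr_ge0 N0 (ltW u0); lra.
have above_small phi : above (- N) phi -> 0 < phi y.
  move=> [Bphi bphi]; rewrite ltNge; apply/negP => u0.
  have := H _ Bphi; have := vW _ Bphi => vphi; rewrite ler0_norm// => h.
  have ue : - phi y <= e by apply: WN; [rewrite oppr_ge0|lra].
  have := h ue; have : 0 <= N * - phi y by rewrite mulr_ge0// oppr_ge0.
  lra.
pose h := (d'' - d') / (`|y| + 1).
have y1 : 0 < `|y| + 1 by rewrite ltr_wpDl.
have h0 : 0 < h by rewrite divr_gt0// subr_gt0.
have hE : h * (`|y| + 1) = d'' - d' by rewrite divfK// gt_eqF.
have above_pos j phi : above (- N + j%:R * h) phi -> 0 < phi y.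
  elim: j phi => [|j IH] phi; first by rewrite mul0r addr0; exact: above_small.
  move=> [Bphi bphi]; rewrite ltNge; apply/negP => u0.
  have [psi bpsi] := aboveP (- N + j%:R * h); have v0 := IH _ bpsi.
  move: bpsi => [Bpsi bpsi].
  pose b := - N + j%:R * h; pose t := - phi y / (psi y - phi y).
  have uv : 0 < psi y - phi y by lra.
  have tE : t * (psi y - phi y) = - phi y by rewrite divfK// gt_eqF.
  have t01 : 0 <= t <= 1.
    rewrite divr_ge0 ?oppr_ge0// ?(ltW uv)//= ler_pdivrMr//; lra.
  pose chi z := t * psi z + (1 - t) * phi z.
  have chiy : chi y = 0 by rewrite /chi; lra.
  have := H chi (Bconv _ _ _ Bpsi Bphi t01); rewrite chiy normr0 => /(_ (ltW e0)).
  rewrite (Phi_conv (B1 _ Bpsi) (B1 _ Bphi) t01).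
  have {}bphi : d'' + b * phi y + h * phi y < Phi phi - phi x.
    by move: bphi; rewrite -natr1 /b; lra.
  have {}bpsi : d'' + b * psi y < Phi psi - psi x by move: bpsi; rewrite -/b; lra.
  have hy : - (h * phi y) <= d'' - d' - h.
    have : h * - phi y <= h * `|y|.
      rewrite ler_pM2l//; have := (B1 _ Bphi).2 y; rewrite mul1r ler_norml; lra.
    by move: hE; lra.
  move/andP: t01 => [t0 t1].
  have := ler_wpM2l t0 (ltW bpsi).
  have : (1 - t) * (d'' + b * phi y + h * phi y) <= (1 - t) * (Phi phi - phi x).
    by rewrite ler_wpM2l ?subr_ge0// ltW.
  have : (1 - t) * - (h * phi y) <= - (h * phi y).
    rewrite -[leRHS]mul1r ler_wpM2r ?gerBl// -mulrN mulr_ge0 ?oppr_ge0//; exact: ltW.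
  have : b * chi y = 0 by rewrite chiy mulr0.
  rewrite /chi; lra.
pose J := Num.truncn (2 * N / h).
have JN : N <= - N + J.+1%:R * h.
  have := truncnS_gt (2 * N / h); rewrite -/J ltr_pdivrMr//; lra.
have [psi bpsi] := aboveP (- N + J.+1%:R * h).
by have := above_pos _ _ bpsi; rewrite ltNge (above_large _ _ JN bpsi).
Qed.

Lemma far_from_points_seq d (l : seq X) (eta : nat -> R) :
  (forall i, 0 < eta i) -> far_from_points d (dual_ball 1) ->
  far_from_points d [set phi | dual_ball 1 phi /\
    forall i, (i < size l)%N -> `|phi (nth 0 l i)| <= eta i].
Proof.
move=> eta0 far; elim/last_ind: l => [|l y IH].
  by move=> x d' /far-/(_ x)[phi phi1 h]; exists phi.
move: IH => /(@far_from_points_small _ _ y _ (eta0 (size l))) IH x d' d'd.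
have [|phi psi t [phi1 phil] [psi1 psil] t01|phi [[phi1 phil] phiy] h] := IH _ _ x d' d'd.
- by move=> phi [].
- split=> [|i il]; first exact: dual_ball_conv.
  apply: le_trans (ler_normD _ _) _; rewrite !normrM.
  have /andP[t0 t1] := t01; have t10 : 0 <= 1 - t by rewrite subr_ge0.
  rewrite (ger0_norm t0) (ger0_norm t10).
  have := ler_wpM2l t0 (phil i il).
  have : (1 - t) * `|psi (nth 0 l i)| <= (1 - t) * eta i.
    by rewrite ler_wpM2l ?subr_ge0// psil.
  lra.
- exists phi => //; split=> // i; rewrite size_rcons ltnS leq_eqVlt nth_rcons.
  by case: ltngtP => //= [il _|-> _ //]; exact: phil.
Qed.

End filter_functional.

(** The model is the summing basis [s_i = e_0 + .. + e_i] of the space of null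
    sequences, where the [k]-th coordinate functional takes the value [1] at
    [s_i] if [k <= i], and [0] otherwise. The errors are summable in [i],
    uniformly in [k]. *)
Definition james_sequence (R : realType) (X : normedModType R) (d : R)
    (x : nat -> X) :=
  exists (phi : nat -> X -> R) (th : nat -> R), forall k,
    [/\ dual_ball 1 (phi k), d <= th k &
      forall i, `|phi k (x i) - (k <= i)%:R * th k| <= d / 8 * 2^-1 ^+ i].

Lemma james_subsequence (R : realType) (X : normedModType R) (d : R)
    (x : nat -> X) (g : nat -> nat) : 0 <= d -> {homo g : m n / (m < n)%N} ->
  james_sequence d x -> james_sequence d (x \o g).
Proof.
move=> d0 ginc [phi [th phiP]]; exists (phi \o g), (th \o g) => k.
have [phi1 dth phix] := phiP (g k); split=> // i.
have -> : (k <= i)%N = (g k <= g i)%N.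
  case: (ltngtP k i) => [/ginc/ltnW->|/ginc|->]//; last by rewrite leqnn.
  by rewrite ltnNge => /negPf.
apply: le_trans (phix (g i)) _; rewrite ler_wpM2l ?divr_ge0//.
have gi := increasing_ge_id ginc i.
by rewrite ler_wiXn2l// ?invr_ge0// invf_le1 ?ler1n.
Qed.

(** Apply the functional whose index maximizes [|tail k a|]: as the coefficients
    are differences of tails, the errors add up to at most half of the main
    term. *)
Lemma james_tail_le (R : realType) (X : normedModType R) (d : R) (x : nat -> X)
    (a : {poly R}) k : 0 < d -> james_sequence d x ->
  d / 2 * `|tail k a| <= `|comb x a|.
Proof.
move=> d0 [phi [th phiP]].
have [m mmax] : exists m, forall k, `|tail k a| <= `|tail m a|.
  pose F (i : 'I_(size a).+1) := `|tail i a|.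
  case: (Order.TotalTheory.arg_maxP F (isT : predT (ord0 : 'I_(size a).+1))) => m _ mP.
  exists m => j; have [ja|aj] := ltnP j (size a).+1; first exact: (mP (Ordinal ja)).
  by rewrite tail_oversize ?normr0// ltnW.
apply: le_trans (_ : d / 2 * `|tail m a| <= _); first by rewrite ler_pM2l ?divr_gt0.
have [phi1 dth phix] := phiP m; set T := `|tail m a| in mmax *.
have T0 : 0 <= T by exact: normr_ge0.
have aT i : `|a`_i| <= 2 * T by exact: norm_coef_tail.
have err : `|phi m (comb x a) - th m * tail m a| <= d / 2 * T.
  rewrite (dual_ball_poly _ _ phi1) tailE mulr_sumr -sumrB.
  apply: le_trans (ler_norm_sum _ _ _) _.
  apply: (@le_trans _ _ (\sum_(i < size a) 2 * T * (d / 8) * 2^-1 ^+ i)).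
    apply: ler_sum => i _; rewrite -[X in _ - X]mulrCA [th m * _]mulrC -mulrBr normrM.
    by rewrite -mulrA; apply: ler_pM.
  rewrite -mulr_sumr; have c0 : 0 <= 2 * T * (d / 8) by rewrite !mulr_ge0// ?divr_ge0// ltW.
  have := ler_wpM2l c0 (sum_geometric_half R (size a)); lra.
have := ler_normB (phi m (comb x a)) (phi m (comb x a) - th m * tail m a).
rewrite subKr normrM -/T; have := ler_norm (th m) => thn.
have := phi1.2 (comb x a); rewrite mul1r.
have : d * T <= `|th m| * T by rewrite ler_wpM2r//; lra.
lra.
Qed.

(** An ultrafilter on [C] without weak limit in [C] gives the functional [Phi].
    The functional [phi n] is nearly zero at the earlier points and has
    [Phi (phi n)] large; the point [x n] nearly agrees with [Phi] at [phi n] and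
    at the earlier functionals. *)
Lemma exists_james_sequence (R : realType) (X : completeNormedModType R) (C : set X) :
  bounded_closed_convex [set: X] C -> ~ weakly_compact C ->
  exists d (x : nat -> X), [/\ 0 < d, forall n, C (x n) & james_sequence d x].
Proof.
move=> [_ _ /pinfty_ex_gt0[M M0 CM] Ccl /convex_setP Cconv].
rewrite /weakly_compact compact_ultra => /existsNP[F] /not_implyP[FU].
move=> /not_implyP[FC Fncvg]; have FF : ProperFilter (F : set_system X) := ultra_proper.
pose Phi (phi : X -> R) := lim (phi x @[x --> F]).
have PhiP phi : dual_ball 1 phi -> phi x @[x --> F] --> Phi phi.
  move=> phi1; suff [l Fl] : exists l : R, phi x @[x --> F] --> l.
    by apply: (@cvgP _ (phi x @[x --> F]) l).
  have FM : F (phi @^-1` [set` `[- M, M]]).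
    apply: filterS FC => x /CM xM /=; rewrite in_itv/= -ler_norml.
    by apply: le_trans (phi1.2 x) _; rewrite mul1r.
  have [l [_ Fl]] := @segment_compact R (- M) M (phi x @[x --> F]) _ FM.
  exists l => B Bl; have [//|FnB] := in_ultra_setVsetC (phi @^-1` B) FU.
  by have [r [nBr Br]] := Fl (~` B) B FnB Bl.
have [|d d0 dP] := Phi_distance FC Ccl Cconv PhiP.
  by move=> [x Cx Fx]; apply: Fncvg; exists x.
have far : far_from_points Phi d (dual_ball 1).
  move=> x d' d'd; have [phi phi1 h] := dP x; exists phi => //; exact: lt_trans h.
pose d2 := d / 2; have d20 : 0 < d2 by rewrite divr_gt0.
have d2d : d2 < d by rewrite /d2; lra.
pose eta i : R := d2 / 8 * 2^-1 ^+ i.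
have eta0 i : 0 < eta i by rewrite mulr_gt0 ?divr_gt0// exprn_gt0// invr_gt0.
pose Q (l : seq (X * (X -> R))) (t : X * (X -> R)) :=
  [/\ C t.1, dual_ball 1 t.2 /\ d2 <= Phi t.2,
    forall i, (i < size l)%N -> `|t.2 (nth (0, fun=> 0) l i).1| <= eta i,
    `|Phi t.2 - t.2 t.1| <= eta (size l) &
    forall i, (i < size l)%N -> `|Phi (nth (0, fun=> 0) l i).2 -
      (nth (0, fun=> 0) l i).2 t.1| <= eta (size l)].
have [l lQ|u uQ] := @history_choice _ (0, fun=> 0) Q.
  have [phi [phi1 phil]] := far_from_points_seq FC PhiP CM (map fst l) eta0 far 0 d2d.
  rewrite (dual_ball0 phi1) subr0 => phid.
  have Fl : F [set x | forall i : 'I_(size l), `|Phi (nth (0, fun=> 0) l i).2 -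
      (nth (0, fun=> 0) l i).2 x| <= eta (size l)].
    apply: filter_forall => i; apply: (Phi_near PhiP) => //.
    by have [_ []] := lQ i (ltn_ord i).
  have [x [[Cx /= xphi] xl]] :=
    filter_ex (filterI (filterI FC (Phi_near PhiP phi1 (eta0 (size l)))) Fl).
  exists (x, phi); split=> //=; first by split=> //; exact: ltW.
    move=> i il; have := phil i; rewrite size_map => /(_ il).
    by rewrite (nth_map (0, fun=> 0)).
  by move=> i il; exact: (xl (Ordinal il)).
exists d2, (fun n => (u n).1); split=> // [n|]; first by have [] := uQ n.
exists (fun k => (u k).2), (fun k => Phi (u k).2) => k.
have [_ [uk1 uk2] uk3 uk4 _] := uQ k; split=> // i; rewrite -/(eta i).
case: (ltngtP k i) => [ki|ik|<-].
- have [_ _ _ _] := uQ i; rewrite size_mkseq => /(_ k ki).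
  by rewrite nth_mkseq// mul1r distrC.
- rewrite mul0r subr0; have := uk3 i; rewrite size_mkseq => /(_ ik).
  by rewrite nth_mkseq.
- by rewrite mul1r distrC; move: uk4; rewrite size_mkseq.
Qed.

(** * Summing basis and l1 basis *)

(** Summation by parts: the sum on the left is a combination of the tails of
    [c]; the weights are the increments of [tau], which are nonnegative and add
    up to at most [1 - t]. *)
Lemma abel_le (R : realType) n (c tau : nat -> R) (t T : R) :
  t <= tau 0%N -> (forall l, tau l <= tau l.+1) -> (forall l, tau l <= 1) ->
  (forall k, `|\sum_(l < n) c l * (k <= l)%:R| <= T) ->
  `|\sum_(l < n) c l * (tau l - t)| <= T * (1 - t).
Proof.
elim: n c tau t => [|n IH] c tau t t0 tauS tau1 cT.
  have := cT 0%N; rewrite !big_ord0 normr0 => T0.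
  by rewrite mulr_ge0// subr_ge0; exact: le_trans (tau1 0%N).
have {}IH := IH (c \o succn) (tau \o succn) (tau 0%N) (tauS 0%N)
  (fun l => tauS l.+1) (fun l => tau1 l.+1).
have -> : \sum_(l < n.+1) c l * (tau l - t) =
    (tau 0%N - t) * (\sum_(l < n.+1) c l * (0 <= l)%:R) +
    \sum_(l < n) (c \o succn) l * ((tau \o succn) l - tau 0%N).
  have -> : \sum_(l < n.+1) c l * (0 <= l)%:R = c 0%N + \sum_(l < n) c l.+1.
    rewrite big_ord_recl mulr1; congr (_ + _); apply: eq_bigr => l _.
    by rewrite mulr1.
  have -> : \sum_(l < n.+1) c l * (tau l - t) =
      c 0%N * (tau 0%N - t) + \sum_(l < n) c l.+1 * (tau l.+1 - t).
    by rewrite big_ord_recl.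
  rewrite [in RHS]mulrDr mulr_sumr -addrA -big_split/= [c 0%N * _]mulrC.
  by congr (_ + _); apply: eq_bigr => l _; ring.
apply: le_trans (ler_normD _ _) _; rewrite normrM ger0_norm ?subr_ge0//.
have /ler_wpM2l -/(_ (tau 0%N - t)) := cT 0%N; rewrite subr_ge0 => /(_ t0).
have : forall k, `|\sum_(l < n) (c \o succn) l * (k <= l)%:R| <= T.
  move=> k; have := cT k.+1; rewrite big_ord_recl ltn0 mulr0 add0r.
  by under eq_bigr do rewrite ltnS.
move=> /IH; lra.
Qed.

(** Exchange the two summations: [y i] occurs in the partial sums of index at
    least [i]. *)
Lemma comb_partial_sums (R : realType) (X : lmodType R) (y : nat -> X) (a : {poly R}) :
  comb (fun n => \sum_(i < n.+1) y i) a = \sum_(i < size a) tail i a *: y i.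
Proof.
rewrite /comb; under [RHS]eq_bigr do rewrite tailE scaler_suml.
rewrite exchange_big/=; apply: eq_bigr => j _.
rewrite (big_ord_widen (size a) y (ltn_ord j)) scaler_sumr big_mkcond/=.
apply: eq_bigr => i _; rewrite ltnS.
by case: (i <= j)%N; rewrite ?mulr1// mulr0 scale0r.
Qed.

(** A special case of Mazur's theorem: if all convex combinations of the [e n]
    with [m <= n] had norm at least [eps], then some functional would be at
    least [eps] at all these [e n]. *)
Lemma weakly_null_convex_comb (R : realType) (X : normedModType R) (e : nat -> X)
    (eps : R) m : 0 < eps -> weakly_cvg e 0 ->
  exists2 a, convex_poly a & `|comb e ('X^m * a)| <= eps.
Proof.
move=> eps0 e_0; apply: contrapT => nex.
pose D := [set comb e ('X^m * a) | a in @convex_poly R].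
have [||d [a a1 <-]|phi phi1 phiD] := @separation R X D 0 eps.
- by exists (comb e ('X^m * 1)), 1 => //; exact: convex_poly1.
- move=> _ _ t [a a1 <-] [b b1 <-] t01; exists (t *: a + (1 - t) *: b).
    exact: convex_poly_conv.
  by rewrite mulrDr -!scalerAr combD !combZ.
- rewrite subr0 leNgt; apply/negP => h; apply: nex; exists a => //; exact: ltW.
have phie0 : phi (e n) @[n --> \oo] --> phi 0 by exact: weak_cvg_ball e_0 phi1.
have /cvgrPdist_lt/(_ _ eps0)[N _ NP] := phie0.
have phie : eps <= phi (e (m + N)%N).
  have := phiD (e (m + N)%N); rewrite subr0; apply.
  exists ('X^N * 1); first by apply: convex_poly_shift; exact: convex_poly1.
  rewrite !comb_mulXn /comb size_poly1 big_ord_recl big_ord0 coef1 scale1r addr0.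
  by rewrite addn0.
have := NP (m + N)%N (leq_addl _ _) => /=; rewrite (dual_ball0 phi1) sub0r normrN.
by rewrite ltNge (le_trans phie (ler_norm _)).
Qed.

Section convex_blocks.
Variables (R : realType) (X : completeNormedModType R) (C : set X) (x y : nat -> X).
Variable d : R.
Hypotheses (hC : bounded_closed_convex [set: X] C) (Cx : forall n, C (x n)).
Hypotheses (d0 : 0 < d) (jx : james_sequence d x).
Hypothesis y_summable :
  forall phi : dual X, (\sum_(0 <= n <oo) (`|phi (y n)|)%:E < +oo)%E.
Hypothesis xy0 : weakly_cvg (fun n => x n - \sum_(i < n.+1) y i) 0.

Let partial_sums_bounded : exists2 K, 0 <= K &
  forall n phi, dual_ball 1 phi -> \sum_(i < n) `|phi (y i)| <= K.
Proof.
apply: uniform_boundedness => phi /dual_of_ball[f fE].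
exists (fine (\sum_(0 <= n <oo) (`|f (y n)|)%:E)%E) => n.
have fin : (\sum_(0 <= n <oo) (`|f (y n)|)%:E)%E \is a fin_num.
  by rewrite ge0_fin_numE ?y_summable//; apply: nneseries_ge0 => i _ _; rewrite lee_fin.
rewrite -lee_fin fineK//.
have <- : (\sum_(0 <= i < n) (`|f (y i)|)%:E = (\sum_(i < n) `|phi (y i)|)%:E)%E.
  by rewrite sumEFin big_mkord; under eq_bigr do rewrite fE.
by apply: nneseries_lim_ge => i _; rewrite lee_fin.
Qed.

Let e n := x n - \sum_(i < n.+1) y i.

Lemma block_sequence : exists (m : nat -> nat) (a : nat -> {poly R}),
  [/\ forall k, m k.+1 = (m k + size (a k))%N, forall k, convex_poly (a k) &
    forall k, `|comb e ('X^(m k) * a k)| <= 2^-1 ^+ k].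
Proof.
pose Q (l : seq (nat * {poly R})) (t : nat * {poly R}) :=
  let p := last (0%N, 0 : {poly R}) l in [/\ t.1 = (p.1 + size p.2)%N, convex_poly t.2 &
    `|comb e ('X^(t.1) * t.2)| <= 2^-1 ^+ size l].
have [l _|u uQ] := @history_choice _ (0%N, 0 : {poly R}) Q.
  have e0 : 0 < (2^-1 : R) ^+ size l by rewrite exprn_gt0// invr_gt0.
  pose p := last (0%N, 0 : {poly R}) l.
  have [a a1 ae] := weakly_null_convex_comb
    (p.1 + size p.2)%N e0 xy0.
  by exists ((p.1 + size p.2)%N, a).
exists (fun k => (u k).1), (fun k => (u k).2); split=> k.
- by have [+ _ _] := uQ k.+1; rewrite mkseqS last_rcons.
- by have [] := uQ k.
- by have [_ _] := uQ k; rewrite size_mkseq.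
Qed.

(** Successive convex blocks [z k] of [x] are so close to the corresponding
    blocks of partial sums of [y] that the upper estimate by the largest tail,
    valid for the latter by summation by parts, holds for [z]; the lower
    estimate by the largest tail is inherited from [x]. So [z] is equivalent to
    the summing basis of the space of null sequences. *)
Lemma convex_blocks_not_generic_FPP :
  ~ generic_FPP C (fun K f =>
    [/\ uniformly_biLipschitz K f, affine_on K f & (0 < theta K f)%E]).
Proof.
have [m [a [mS a1 ae]]] := block_sequence.
pose beta k := 'X^(m k) * a k; pose z k := comb x (beta k).
pose B (b : {poly R}) := \sum_(k < size b) b`_k *: beta k.
have tailB k b : tail k (B b) = \sum_(l < size b) b`_l * tail k (beta l).
  rewrite /B /tail comb_sum; apply: eq_bigr => l _; exact: combZ.
have combB' (w : nat -> X) b : comb w (B b) = \sum_(l < size b) b`_l *: comb w (beta l).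
  by rewrite /B comb_sum; apply: eq_bigr => l _; rewrite combZ.
have zB b : comb z b = comb x (B b) by rewrite combB'.
have mle i j : (i <= j)%N -> (m i <= m j)%N.
  move=> /subnK <-; elim: (j - i)%N => // n /leq_trans; apply.
  by rewrite addSn mS leq_addr.
have tau1 i l : (i <= m l)%N -> tail i (beta l) = 1.
  by rewrite tail_mulXn -subn_eq0 => /eqP ->; have [] := a1 l.
have tau0 i l : (m l.+1 <= i)%N -> tail i (beta l) = 0.
  move=> h; rewrite tail_mulXn tail_oversize// leq_subRL -?mS//.
  by rewrite (leq_trans _ h)// mS leq_addr.
have tau01 i l : 0 <= tail i (beta l) <= 1.
  by apply: tail_convex; exact: convex_poly_shift.
have tauS i l : tail i (beta l) <= tail i (beta l.+1).
  have [il|/ltnW li] := leqP i (m l.+1).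
    by rewrite (tau1 _ _ il); have /andP[] := tau01 i l.
  by rewrite (tau0 _ _ li); have /andP[] := tau01 i l.+1.
have tail_block k b : tail k b = tail (m k) (B b).
  rewrite tailB tailE; apply: eq_bigr => l _; congr (_ * _).
  have [kl|lk] := leqP k l; first by rewrite tau1// mle.
  by rewrite tau0// mle.
have lower k b : d / 2 * `|tail k b| <= `|comb z b|.
  by rewrite tail_block zB; exact: james_tail_le.
have [K K0 KP] := partial_sums_bounded.
have upper T b : (forall k, `|tail k b| <= T) -> `|comb z b| <= (4 + K) * T.
  move=> bT; have T0 : 0 <= T by exact: le_trans (bT 0%N).
  have -> : comb z b = comb e (B b) + comb (fun n => \sum_(i < n.+1) y i) (B b).
    rewrite zB /comb -big_split/=; apply: eq_bigr => i _.
    by rewrite -scalerDr subrK.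
  rewrite mulrDl; apply: le_trans (ler_normD _ _) _; apply: lerD.
    rewrite combB'; apply: le_trans (ler_norm_sum _ _ _) _.
    apply: (@le_trans _ _ (\sum_(l < size b) 2 * T * 2^-1 ^+ l)).
      apply: ler_sum => l _; rewrite normrZ.
      by apply: ler_pM => //; [exact: norm_coef_tail|exact: ae].
    have T20 : 0 <= 2 * T by rewrite mulr_ge0.
    rewrite -mulr_sumr; have := ler_wpM2l T20 (sum_geometric_half R (size b)); lra.
  rewrite comb_partial_sums; apply: norm_le_dual => phi phi1.
  rewrite (dual_ball_sum phi1) mulrC.
  apply: le_trans (ler_wpM2l T0 (KP (size (B b)) phi phi1)); rewrite mulr_sumr.
  apply: ler_sum => i _; rewrite (dual_ballZ phi1).
  apply: le_trans (ler_norm _) _; rewrite normrM ler_wpM2r// tailB.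
  have := abel_le (n := size b) (c := fun l => b`_l)
    (tau := fun l => tail i (beta l)) (t := 0) (T := T).
  rewrite subr0 mulr1; under eq_bigr do rewrite subr0.
  apply=> [|l|l|k].
  - by have /andP[] := tau01 i 0%N.
  - exact: tauS.
  - by have /andP[] := tau01 i l.
  - by rewrite -tailE.
have c0 : 0 < (4 + K) * (2 / d) by rewrite mulr_gt0 ?divr_gt0// ltr_wpDr.
have d20 : 0 < d / 2 by rewrite divr_gt0.
have lower' k b : `|tail k b| <= 2 / d * `|comb z b|.
  by rewrite -[2 / d]invf_div ler_pdivlMl.
have [_ _ _ _ /convex_setP Cconv] := hC.
apply: (shift_not_generic_FPP c0 d20 _ _ lower hC) => [p b|p b|k].
- rewrite -mulrA; apply: upper => k; rewrite tail_mulXn; exact: lower'.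
- rewrite -mulrA; apply: upper => k.
  by rewrite -[k in tail k b](addnK p) -tail_mulXn; exact: lower'.
- exact: (convex_comb_in Cconv Cx (convex_poly_shift (m k) (a1 k))).
Qed.

End convex_blocks.

(** The norm of a combination of [z] is equivalent to the l1 norm of the
    coefficients, which shifts preserve and which dominates tails. *)
Lemma l1_sequence_not_generic_FPP (R : realType) (X : completeNormedModType R)
    (C : set X) (z : nat -> X) (c : R) :
  bounded_closed_convex [set: X] C -> (forall n, C (z n)) -> 0 < c ->
  (forall a : {poly R}, c * (\sum_(i < size a) `|a`_i|) <= `|comb z a|) ->
  ~ generic_FPP C (fun K f =>
    [/\ uniformly_biLipschitz K f, affine_on K f & (0 < theta K f)%E]).
Proof.
move=> hC Cz c0 lower; have [_ _ /pinfty_ex_gt0[M M0 CM] _ _] := hC.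
have upper a : `|comb z a| <= M * \sum_(i < size a) `|a`_i|.
  apply: le_trans (norm_comb _ _) _; rewrite mulr_sumr; apply: ler_sum => i _.
  by rewrite mulrC ler_wpM2r//; exact: CM.
have Mc : 0 < M / c by rewrite divr_gt0.
apply: (shift_not_generic_FPP Mc c0 _ _ _ hC Cz) => [p a|p a|k a].
- apply: le_trans (upper _) _; rewrite sum_norm_mulXn -mulrA ler_pM2l//.
  by rewrite ler_pdivlMl.
- apply: le_trans (upper _) _; rewrite -(sum_norm_mulXn p) -mulrA ler_pM2l//.
  by rewrite ler_pdivlMl.
- by apply: le_trans (lower a); rewrite ler_pM2l// norm_tail_l1.
Qed.

Theorem theorem6p1 (R : realType) (X : completeNormedModType R)
    (hu : property_u X) (C : set X)
    (hC : bounded_closed_convex [set: X] C) :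
  weakly_compact C <->
  generic_FPP C (fun K f =>
    [/\ uniformly_biLipschitz K f, affine_on K f & (0 < theta K f)%E]).
Proof.
split=> [Ccpt K [KC K0 Kbd Kcl Kconv] f fK [[c1 [c2 [_ _ flip]]] faff _]|CFPP].
  apply: (@weakly_compact_fixed_point _ _ K f _ fK faff C c2) => //.
    exact: convex_setP.
  by move=> x y Kx Ky; have /andP[] := flip x y 1%N Kx Ky isT.
apply: contrapT => nCcpt.
have [d [x [d0 Cx jx]]] := exists_james_sequence hC nCcpt.
have [_ _ /pinfty_ex_gt0[M _ CM] _ _] := hC.
have [[g ginc gcauchy]|[g [c [c0 xg]]]] := rosenthal_l1 (fun n => CM _ (Cx n)).
  have [y [ysum xy0]] := hu _ gcauchy.
  exact: (@convex_blocks_not_generic_FPP _ _ C (x \o g) y d hC (fun n => Cx (g n)) d0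
    (james_subsequence (ltW d0) ginc jx) ysum xy0 CFPP).
exact: (l1_sequence_not_generic_FPP hC (fun n => Cx (g n)) c0 xg CFPP).
Qed.
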